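(* Let $d\in\mathbb{N}$ and $s>1/2$. There is a constant $C_{s,d}>0$ depending only on $s$ and $d$ such that for all $n\geq 2$ $$g_n\big(\mathrm{Id}_{s,d}:H^s_{\mathrm{mix}}(\mathbb{T}^d)\to L_2(\mathbb{T}^d)\big)\;\leq\; C_{s,d}\,n^{-s}(\log n)^{(d-1)s+1/2}.$$
   Context: $\mathbb{T}^d\simeq[0,1)^d$ is the $d$-dimensional torus ($\mathbb{T}=[0,1]$ with endpoints identified), equipped with Lebesgue measure, which is a probability measure on it. For $s>0$ and $k\in\mathbb{Z}$ put $w_s(k)=(1+(2\pi|k|)^{2s})^{1/2}$. $H^s_{\mathrm{mix}}(\mathbb{T}^d)$ is the Hilbert space of functions on $\mathbb{T}^d$ with inner product $$\langle f,g\rangle_{H^s_{\mathrm{mix}}}=\sum_{\mathbf{k}\in\mathbb{Z}^d}\hat f_{\mathbf{k}}\,\overline{\hat g_{\mathbf{k}}}\prod_{j=1}^d w_s(k_j)^2,$$ where $\hat f_{\mathbf{k}}=\int_{\mathbb{T}^d} f(\mathbf{x})e^{-2\pi\mathrm{i}\,\mathbf{k}\cdot\mathbf{x}}\,d\mathbf{x}$ are the Fourier coefficients. For $s>1/2$ it is a reproducing kernel Hilbert space (of continuous functions) with kernel $K^d_s(\mathbf{x},\mathbf{y})=\prod_{j=1}^d K^1_s(x_j,y_j)$, where $K^1_s(x,y)=\sum_{k\in\mathbb{Z}}\frac{\exp(2\pi\mathrm{i}k(y-x))}{w_s(k)^2}$. The sampling numbers are $$g_n(\mathrm{Id}_{s,d})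 := \inf_{\mathbf{x}^1,\dots,\mathbf{x}^n\in\mathbb{T}^d}\ \inf_{\varphi:\mathbb{C}^n\to L_2(\mathbb{T}^d)}\ \sup_{\|f\|_{H^s_{\mathrm{mix}}}\leq 1}\big\|f-\varphi(f(\mathbf{x}^1),\dots,f(\mathbf{x}^n))\big\|_{L_2(\mathbb{T}^d)},$$ where $\varphi$ ranges over all maps. $\log$ is the natural logarithm. *)

(* Defs.v *)
From HB Require Import structures.
From mathcomp Require Import all_boot all_order all_algebra.
From mathcomp Require Import all_classical all_reals all_analysis.
From mathcomp Require Import complex.

Set Implicit Arguments.
Unset Strict Implicit.
Unset Printing Implicit Defensive.
Import Order.TTheory GRing.Theory Num.Theory.
Import numFieldNormedType.Exports.

Local Open Scope classical_set_scope.
Local Open Scope ring_scope.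
Local Open Scope complex_scope.

(** Points of R^d are [d.-tuple R].  A function on the torus T^d = R^d / Z^d is
    represented by a function on R^d that is 1-periodic in each coordinate, and
    T^d itself by the fundamental domain [0,1)^d. *)

Section torus_measure.
Context {R : realType}.

Definition circle_measure :=
  mrestr (@lebesgue_measure R) (measurable_itv (`[0%R, 1%R[ : interval R)).

HB.instance Definition _ := Measure.on circle_measure.

Let circle_measure_setT : circle_measure setT = 1%E.
Proof.
by rewrite /circle_measure /mrestr setTI lebesgue_measure_itv/= lte01 sube0.
Qed.

HB.instance Definition _ :=
  Measure_isProbability.Build _ _ R circle_measure circle_measure_setT.

Section tuple_cons.
Context {d : nat}.

Definition tuple_cons (x : measurableTypeR R * d.-tuple R) : d.+1.-tuple R :=
  [tuple of x.1 :: x.2].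

Let measurable_tuple_cons : measurable_fun setT tuple_cons.
Proof. exact: measurable_cons. Qed.

HB.instance Definition _ :=
  isMeasurableFun.Build _ _ _ _ tuple_cons measurable_tuple_cons.

End tuple_cons.

(** The d-fold product of Lebesgue measure on [0,1), carried by [0,1)^d. *)
Fixpoint torus_measure (d : nat) : probability (d.-tuple R) R :=
  match d with
  | 0 => \d_ [tuple]
  | d'.+1 => distribution (circle_measure \x torus_measure d')%E tuple_cons
  end.

End torus_measure.

Arguments torus_measure R d : clear implicits.

Section Hmix.
Context {R : realType} {d : nat}.
Implicit Types (f g h : d.-tuple R -> R[i]) (k : d.-tuple int) (s : R).

Definition in_cube (x : d.-tuple R) : Prop := forall j, 0 <= tnth x j < 1.

Definition periodic f : Prop := forall (k : d.-tuple int) (x : d.-tuple R),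
  f [tuple tnth x j + (tnth k j)%:~R | j < d] = f x.

(** Tuples carry no topology, hence the detour through row vectors. *)
Definition torus_continuous f : Prop :=
  periodic f /\
  continuous ((fun x => f [tuple x ord0 j | j < d]) : 'rV[R]_d -> R[i]^o).

Definition cintegral f : R[i] :=
  (\int[torus_measure R d]_x complex.Re (f x)) +i*
  (\int[torus_measure R d]_x complex.Im (f x)).

Definition cexpi (t : R) : R[i] := cos t +i* sin t.

Definition fourier_coef f k : R[i] :=
  cintegral (fun x =>
    f x * cexpi (- (2 * pi * \sum_(j < d) (tnth k j)%:~R * tnth x j))).

Definition weight s (k : int) : R :=
  Num.sqrt (1 + (2 * pi * `|k%:~R|) `^ (2 * s)).

(** The norm of H^s_mix, equal to [+oo] when the series diverges. *)
Definition Hmix_norm s f : \bar R :=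
  sqrte (\esum_(k in [set: d.-tuple int])
    (Normc.normc (fourier_coef f k) ^+ 2 *
     \prod_(j < d) weight s (tnth k j) ^+ 2)%:E).

(** For s > 1/2 every element of H^s_mix has exactly one continuous
    representative; it is the one whose point values are sampled. *)
Definition Hmix s : set (d.-tuple R -> R[i]) :=
  [set f | torus_continuous f /\ (Hmix_norm s f < +oo)%E].

Definition L2_norm h : \bar R :=
  'N[torus_measure R d]_2%:E[(fun x => (Normc.normc (h x))%:E)].

(** Representatives of the elements of L_2(T^d): [torus_measure] only sees the
    values on [0,1)^d, so periodicity is not demanded. *)
Definition L2 : set (d.-tuple R -> R[i]) :=
  [set h | [/\ measurable_fun setT (fun x => complex.Re (h x)),
               measurable_fun setT (fun x => complex.Im (h x)) &
               (L2_norm h < +oo)%E]].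

Definition worst_case_error s n (xs : n.-tuple (d.-tuple R))
    (phi : n.-tuple R[i] -> d.-tuple R -> R[i]) : \bar R :=
  ereal_sup [set L2_norm (f \- phi [tuple f (tnth xs i) | i < n])
            | f in [set f | Hmix s f /\ (Hmix_norm s f <= 1)%E]].

End Hmix.

Definition sampling_number (R : realType) (d : nat) (s : R) (n : nat) : \bar R :=
  ereal_inf [set ereal_inf [set worst_case_error s xs phi
                           | phi in [set phi | forall y, L2 (phi y)]]
            | xs in [set xs : n.-tuple (d.-tuple R) |
                     forall i, in_cube (tnth xs i)]].

(* Main.v *)
Require Import Defs.
From mathcomp Require Import all_boot all_order all_algebra.
From mathcomp Require Import all_classical all_reals all_analysis.
From mathcomp Require Import measurable_realfun complex.
From mathcomp Require Import ring lra zify.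

(* Since phi is arbitrary, sending each data vector to some element of the unit
   ball with these data reduces the theorem to one bound: if h in H^s_mix vanishes
   at the n points then ||h||_2^2 <= C lam ||h||_H^2, with lam = b^(-2s) and
   b ~ n / (log n)^(d-1).  It suffices to find points, and a constant B, such that
     ||p||_2^2 <= 2 lam ||p||_H^2 + B sum_i |p(x_i)|^2
   for all trigonometric polynomials p of large degree: apply this to Fejer-type
   means of h, whose H-norms are at most that of h and which converge to h.

   The points come from the lower barrier of Batson, Spielman and Srivastava.
   Start from the form B_0 = lam W + 1, with W the diagonal of the squared weights,
   and alternately subtract delta * 1 and add 8 delta u u^T, where u evaluates p at a
   suitably chosen point.  The potential Tr B^(-1) can be kept below its
   initial bound Phi = n/8 with delta = 1 / (4 Phi) = 2 / n, because the average of
   u u^T over the torus is the identity.  After n steps 2 has been subtracted, and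
   positivity of the final form is the inequality above.  Neither Phi nor the weight
   8 delta depends on the number of frequencies, so all frequencies outside a
   large box can be treated as an error term.

   The starting condition Tr B_0^(-1) <= n/8 is a bound on sum_k 1 / (1 + lam W_k):
   one coordinate is summed exactly and the others with the exponent
   r = 1 + c / log n (Rankin's trick), giving a multiple of b (log n)^(d-1). *)

Set Implicit Arguments.
Unset Strict Implicit.
Unset Printing Implicit Defensive.
Import Order.TTheory GRing.Theory Num.Theory.
Import numFieldNormedType.Exports.
Local Open Scope classical_set_scope.
Local Open Scope ring_scope.
Local Open Scope complex_scope.

(** * The barrier method *)

Section QuadraticForms.
Variables (R : realFieldType) (n : nat).
Implicit Types (B Q : 'M[R]_n) (x y z u : 'rV[R]_n).

Definition qform B x : R := (x *m B *m x^T) 0 0.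

Definition dotr x y : R := (x *m y^T) 0 0.

Definition posdef B := B^T = B /\ forall x, x != 0 -> 0 < qform B x.

Lemma dotrE x y : dotr x y = \sum_i x 0 i * y 0 i.
Proof. by rewrite /dotr mxE; apply: eq_bigr => i _; rewrite mxE. Qed.

Lemma dotrC x y : dotr x y = dotr y x.
Proof. by rewrite !dotrE; apply: eq_bigr => i _; rewrite mulrC. Qed.

Lemma qformE B x : qform B x = dotr (x *m B) x.
Proof. by []. Qed.

Lemma qform0 B : qform B 0 = 0.
Proof. by rewrite /qform !mul0mx mxE. Qed.

Lemma qformDl B Q x : qform (B + Q) x = qform B x + qform Q x.
Proof. by rewrite /qform mulmxDr mulmxDl mxE. Qed.

Lemma qformZl (a : R) B x : qform (a *: B) x = a * qform B x.
Proof. by rewrite /qform -scalemxAr -scalemxAl mxE. Qed.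

Lemma qform_scalar (a : R) x : qform a%:M x = a * dotr x x.
Proof. by rewrite /qform mul_mx_scalar -scalemxAl mxE. Qed.

Lemma qform_outer u x : qform (u^T *m u) x = dotr u x ^+ 2.
Proof.
rewrite /qform mulmxA -mulmxA mxE big_ord1 expr2.
by rewrite -/(dotr x u) -/(dotr u x) dotrC.
Qed.

Lemma dotr_ge0 x : 0 <= dotr x x.
Proof. by rewrite dotrE sumr_ge0 // => i _; rewrite -expr2 sqr_ge0. Qed.

Lemma dotr_gt0 x : x != 0 -> 0 < dotr x x.
Proof.
move=> x0; rewrite lt_neqAle dotr_ge0 andbT eq_sym dotrE.
apply: contra x0; rewrite psumr_eq0 => [/allP xE|i _]; last by rewrite -expr2 sqr_ge0.
apply/eqP/rowP => i; rewrite mxE; apply/eqP.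
by have := xE i (mem_index_enum i); rewrite mulf_eq0 orbb.
Qed.

Lemma dotr_delta x i : dotr x (delta_mx 0 i) = x 0 i.
Proof. by rewrite /dotr trmx_delta -colE mxE. Qed.

Lemma qform_delta B i : qform B (delta_mx 0 i) = B i i.
Proof. by rewrite /qform -rowE -/(dotr _ _) dotr_delta mxE. Qed.

Section PosDef.
Variable B : 'M[R]_n.
Hypothesis pB : posdef B.

Lemma posdef_ge0 x : 0 <= qform B x.
Proof. by have [->|/pB.2/ltW] := eqVneq x 0; rewrite ?qform0. Qed.

Lemma posdef_unit : B \in unitmx.
Proof.
rewrite -row_free_unit -kermx_eq0; apply/eqP/row_matrixP => i.
apply/eqP; rewrite row0; apply: contraT => /pB.2.
by rewrite /qform -row_mul mulmx_ker row0 mul0mx mxE ltxx.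
Qed.

Lemma posdef_invC : (invmx B)^T = invmx B.
Proof. by rewrite trmx_inv pB.1. Qed.

Lemma qform_inv x : qform (invmx B) x = qform B (x *m invmx B).
Proof.
by rewrite /qform -!mulmxA trmx_mul posdef_invC (mulKVmx posdef_unit).
Qed.

Lemma posdef_inv : posdef (invmx B).
Proof.
split=> [|x x0]; first exact: posdef_invC.
rewrite qform_inv pB.2 //; apply: contra x0 => /eqP.
by move=> /(congr1 (mulmx^~ B)); rewrite (mulmxKV posdef_unit) mul0mx => ->.
Qed.

(** Cauchy-Schwarz for the inner product of [B], applied to [z] and [y *m invmx B]. The proof
    expands [qform B] at [z] minus its [B]-orthogonal projection onto [y *m invmx B]. *)
Lemma posdef_CS y z : dotr z y ^+ 2 <= qform (invmx B) y * qform B z.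
Proof.
have [->|y0] := eqVneq y 0.
  by rewrite qform0 mul0r dotrC /dotr mul0mx mxE expr0n.
set q := qform (invmx B) y; set r := dotr z y.
have q0 : 0 < q by exact: posdef_inv.2.
have := posdef_ge0 (z - (r / q) *: (y *m invmx B)).
have -> : qform B (z - (r / q) *: (y *m invmx B)) = qform B z - r ^+ 2 / q.
  set v := y *m invmx B.
  have vB : v *m B = y by rewrite /v (mulmxKV posdef_unit).
  have yv : (y *m v^T) 0 0 = q by rewrite /v trmx_mul posdef_invC mulmxA.
  clearbody v.
  have Bv : B *m v^T = y^T by rewrite -vB trmx_mul pB.1.
  rewrite /qform [(_ - _)^T]raddfB /= [(_ *: v)^T]linearZ /= !(mulmxBl, mulmxBr).
  rewrite -!scalemxAl -!scalemxAr vB -[z *m B *m v^T]mulmxA Bv.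
  have yz : (y *m z^T) 0 0 = r by exact: dotrC.
  have : (z *m y^T) 0 0 = r by [].
  move: {yz} (y *m z^T) yz (z *m y^T) (y *m v^T) yv (z *m B *m z^T) => P Pr S V qE T Sr.
  rewrite !mxE Pr Sr qE.
  by field; rewrite gt_eqF.
by rewrite subr_ge0 ler_pdivrMr // mulrC.
Qed.

(** The least eigenvalue of [B] is at least the reciprocal of the trace of the inverse. No spectral
    theory is used: [posdef_CS] is summed over the standard basis. *)
Lemma posdef_trace_lb z : dotr z z <= \tr (invmx B) * qform B z.
Proof.
rewrite dotrE /mxtrace mulr_suml ler_sum // => i _.
by rewrite -expr2 -{1}[z 0 i]dotr_delta -qform_delta posdef_CS.
Qed.

End PosDef.

Lemma posdef_diag_gt0 B i : posdef B -> 0 < B i i.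
Proof.
move=> [_ pB]; rewrite -qform_delta pB //; apply/eqP => /rowP/(_ i).
by rewrite !mxE !eqxx /= => /eqP; rewrite oner_eq0.
Qed.

Lemma posdef_trace_ge0 B : posdef B -> 0 <= \tr B.
Proof. by move=> pB; rewrite sumr_ge0 // => i _; rewrite ltW ?posdef_diag_gt0. Qed.

(* The comparison holds for each diagonal entry: apply [posdef_CS] for [B] to the
   corresponding row of [invmx B']. *)
Lemma posdef_inv_trace_le (B B' : 'M[R]_n) : posdef B -> posdef B' ->
  (forall x, qform B x <= 2 * qform B' x) -> \tr (invmx B') <= 2 * \tr (invmx B).
Proof.
move=> pB pB' le2; rewrite /mxtrace mulr_sumr ler_sum // => i _.
set X := invmx B'; set e : 'rV[R]_n := delta_mx 0 i.
have X0 : 0 < X i i by apply: posdef_diag_gt0; exact: posdef_inv.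
have := posdef_CS pB e (e *m X).
rewrite dotr_delta -rowE mxE qform_delta => CS.
have Y0 : 0 < invmx B i i by apply: posdef_diag_gt0; exact: posdef_inv.
have qX : qform B' (row i X) = X i i.
  by rewrite rowE -(qform_inv pB') qform_delta.
have := le2 (row i X); rewrite qX => le2X.
rewrite -(ler_pM2r X0) -expr2 (le_trans CS)//.
by rewrite (mulrC 2) -mulrA ler_pM2l.
Qed.

(** The rank-one update formula for the inverse is checked by multiplying out; cyclicity of the
    trace turns the correction term into a quadratic form at [u]. *)
Lemma sherman_morrison B u (t : R) : posdef B -> 0 <= t ->
  \tr (invmx (B + t *: (u^T *m u))) =
  \tr (invmx B) - t * qform (invmx B *m invmx B) u / (1 + t * qform (invmx B) u).
Proof.
move=> pB t0; set X := invmx B; set q := qform X u.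
have uB := posdef_unit pB.
have q0 : 0 <= q by apply: posdef_ge0; exact: posdef_inv.
have q1 : 1 + t * q != 0 by rewrite gt_eqF// ltr_pwDl// mulr_ge0.
set a := t / (1 + t * q).
have scal (v : 'M[R]_1) : v = (v 0 0)%:M by apply: mx11_scalar.
suff -> : invmx (B + t *: (u^T *m u)) = X - a *: (X *m u^T *m u *m X).
  rewrite raddfB /= linearZ /=; congr (_ - _).
  by rewrite -mulmxA mxtrace_mulC trace_mx11 /qform !mulmxA /a mulrAC.
have eq1 : (B + t *: (u^T *m u)) *m (X - a *: (X *m u^T *m u *m X)) = 1%:M.
  rewrite mulmxBr !mulmxDl (mulmxV uB) -!scalemxAl -!scalemxAr.
  rewrite !mulmxA (mulmxV uB) mul1mx.
  have -> : u^T *m u *m X *m u^T *m u *m X = q *: (u^T *m u *m X).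
    transitivity (u^T *m (u *m X *m u^T) *m (u *m X)); first by rewrite !mulmxA.
    by rewrite [u *m X *m u^T]scal mul_mx_scalar -!scalemxAl !mulmxA.
  set V := u^T *m u *m X.
  have -> : a *: V + t *: (a *: (q *: V)) = t *: V.
    by rewrite !scalerA -scalerDl; congr (_ *: _); rewrite /a; field.
  by rewrite addrK.
by rewrite -[LHS]mulmx1 -eq1 mulKmx //; case: (mulmx1_unit eq1).
Qed.

Lemma mxtrace_conj_ge0 (A B : 'M[R]_n) : posdef B -> 0 <= \tr (A *m B *m A^T).
Proof.
move=> pB; rewrite sumr_ge0 // => i _.
have -> : (A *m B *m A^T) i i = qform B (row i A); last exact: posdef_ge0.
rewrite /qform -row_mul tr_row !mxE; apply: eq_bigr => j _.
by rewrite [row _ _ _ _]mxE [col _ _ _ _]mxE.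
Qed.

(** * One step of the lower barrier argument and its iteration *)

Section BarrierStep.
Variables (I : Type) (u : I -> 'rV[R]_n).
Hypothesis n0 : (0 < n)%N.
Hypothesis mean : forall Q, 0 < \tr Q -> exists i, \tr Q / 4 <= qform Q (u i).

(** Subtracting [del] raises the potential by [D], and the update with weight [t = 8 * del] lowers
    it by the Sherman-Morrison term. The gain covers the loss as soon as [D <= t * qform Q u], where
    [Q = X *m X - D *: X]. Since [\tr Q] is at least half of [T = \tr (X *m X)], some [u] has
    [qform Q u >= T / 8], and [t * (T / 8) = del * T >= D]. *)
Lemma barrier_step B (Phi : R) : 0 < Phi -> posdef B -> \tr (invmx B) <= Phi ->
  let del := (4 * Phi)^-1 in
  exists i, let B' := B - del%:M + (8 * del) *: ((u i)^T *m u i) in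
    posdef B' /\ \tr (invmx B') <= Phi.
Proof.
move=> Phi0 pB trB del.
have del0 : 0 < del by rewrite invr_gt0 mulr_gt0.
have delPhi : del * Phi = 1 / 4 by rewrite /del; field; rewrite gt_eqF.
set C := B - del%:M.
(* By [posdef_trace_lb] and [del * Phi = 1 / 4] the shift removes at most a quarter of
   [qform B x]. *)
have half x : qform B x <= 2 * qform C x.
  have := posdef_trace_lb pB x.
  have -> : qform C x = qform B x - del * dotr x x.
    by rewrite -qform_scalar /C qformDl -scaleN1r qformZl mulN1r.
  move/(le_trans)/(_ (ler_wpM2r (posdef_ge0 pB x) trB)).
  rewrite -(ler_pM2l del0) mulrA delPhi.
  by have := posdef_ge0 pB x; lra.
have pC : posdef C.
  split=> [|x x0]; first by rewrite /C raddfB /= pB.1 tr_scalar_mx.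
  have := half x; have := pB.2 x x0; lra.
set X := invmx C; set Y := invmx B.
have trX : \tr X <= 2 * Phi.
  by rewrite (le_trans (posdef_inv_trace_le pB pC half))// ler_pM2l.
have uB := posdef_unit pB; have uC := posdef_unit pC.
(* The resolvent identity. It gives [D = del * \tr (X *m Y)] and, applied once more,
   [\tr (X *m Y) <= T]. *)
have XY : X - Y = del *: (X *m Y).
  have -> : X - Y = X *m (B - C) *m Y.
    by rewrite mulmxBr mulmxBl (mulVmx uC) mul1mx -mulmxA (mulmxV uB) mulmx1.
  by rewrite /C opprB addrC subrK mul_mx_scalar -scalemxAl.
have pX : posdef X by exact: posdef_inv.
have pY : posdef Y by exact: posdef_inv.
set T := \tr (X *m X).
have T0 : 0 < T.
  have := posdef_diag_gt0 (Ordinal n0) pX; set i0 := Ordinal n0 => Xi.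
  rewrite /T -{1}pX.1 /mxtrace (bigD1 i0)//= ltr_pwDl ?sumr_ge0//; last first.
    by move=> i _; rewrite mxE sumr_ge0// => j _; rewrite mxE -expr2 sqr_ge0.
  rewrite mxE (bigD1 i0)//= ltr_pwDl ?sumr_ge0//.
    by rewrite mxE mulr_gt0.
  by move=> j _; rewrite mxE -expr2 sqr_ge0.
have trXY : \tr (X *m Y) <= T.
  rewrite -subr_ge0 /T -raddfB /= -mulmxBr XY -scalemxAr linearZ /= mulr_ge0 ?(ltW del0)//.
  by rewrite mxtrace_mulC; have := mxtrace_conj_ge0 X pY; rewrite pX.1.
set D := \tr X - \tr Y.
have DT : D <= del * T.
  by rewrite /D -raddfB /= XY linearZ /= ler_pM2l.
have trX0 : 0 <= \tr X by exact: posdef_trace_ge0.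
pose Q := X *m X - D *: X.
have trQ : T / 2 <= \tr Q.
  rewrite /Q raddfB /= linearZ /= -/T.
  have h1 : D * \tr X <= del * T * \tr X by rewrite ler_wpM2r.
  have h2 : del * T * \tr X <= del * T * (2 * Phi) by rewrite ler_wpM2l// mulr_ge0// ltW.
  have -> : T / 2 = T - del * T * (2 * Phi).
    by rewrite (mulrC del) -mulrA [del * _]mulrCA delPhi; field.
  by lra.
have [|i Qi] := mean (Q := Q); first by rewrite (lt_le_trans _ trQ)// divr_gt0.
exists i => /=; set t := 8 * del.
have t0 : 0 < t by rewrite mulr_gt0.
split.
  split=> [|x x0].
    by rewrite raddfD /= linearZ /= trmx_mul trmxK pC.1.
  rewrite qformDl qformZl qform_outer ltr_pwDl// ?pC.2//.
  by rewrite mulr_ge0 ?sqr_ge0// ltW.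
rewrite (sherman_morrison _ pC (ltW t0)) -/X.
set q := qform X (u i).
have q0 : 0 <= q by exact: posdef_ge0.
have q1 : 0 < 1 + t * q by rewrite ltr_pwDl// mulr_ge0// ltW.
apply: le_trans trB; rewrite -/Y lerBlDr addrC -lerBlDr -/D ler_pdivlMr//.
have : D * (1 + t * q) = D + t * (D * q) by ring.
move=> ->; rewrite -lerBrDr -mulrBr.
have -> : qform (X *m X) (u i) - D * q = qform Q (u i).
  by rewrite /Q qformDl -(scaleNr D X) qformZl mulNr.
have : t * (T / 8) <= t * qform Q (u i) by rewrite ler_pM2l//; lra.
by apply: le_trans; rewrite /t; move: DT; lra.
Qed.

(** Positivity of the form reached after [m] steps, with [m * del] subtracted and rank-one terms of
    weight [8 * del = 2 / Phi] added. The potential bound is carried along only to feed the next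
    step. *)
Theorem barrier_selection m B0 (Phi : R) : 0 < Phi -> posdef B0 ->
    \tr (invmx B0) <= Phi ->
  exists f : 'I_m -> I, forall x,
    m%:R / (4 * Phi) * dotr x x <=
    qform B0 x + 2 / Phi * \sum_i dotr (u (f i)) x ^+ 2.
Proof.
move=> Phi0 pB0 trB0; set del := (4 * Phi)^-1.
suff [f [pB _]] : exists f : 'I_m -> I,
    let B := B0 - (m%:R * del)%:M + (8 * del) *: \sum_i ((u (f i))^T *m u (f i)) in
    posdef B /\ \tr (invmx B) <= Phi.
  exists f => x; have := posdef_ge0 pB x.
  rewrite !qformDl -scaleN1r !qformZl qform_scalar.
  rewrite /qform mulmx_sumr mulmx_suml summxE.
  under eq_bigr do rewrite -/(qform _ _) qform_outer.
  rewrite -/(qform _ _) mulN1r addrAC subr_ge0 => /le_trans; apply.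
  by rewrite /del invfM mulrA; have -> : 8 * 4^-1 = 2 :> R by field.
elim: m => [|m [f IH]].
  exists (fun i : 'I_0 => False_rect _ (notF (valP i))) => /=.
  by rewrite mul0r big_ord0 scaler0 addr0 raddf0 subr0.
have [i H] := barrier_step Phi0 IH.1 IH.2.
exists (fun j => if unlift ord_max j is Some k then f k else i) => /=.
rewrite big_ord_recr /= unlift_none.
under eq_bigr => k _.
  have -> : widen_ord (leqnSn m) k = lift ord_max k.
    by apply: val_inj; rewrite /= /bump leqNgt ltn_ord.
  rewrite liftK; over.
set S := \sum_(k < m) _ in IH H *; rewrite -natr1 mulrDl mul1r raddfD /= scalerDr opprD !addrA.
by rewrite [X in X + 8 * del *: ((u i)^T *m u i)]addrAC.
Qed.
End BarrierStep.
End QuadraticForms.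

(** * Integrals of trigonometric functions over the torus *)

Section IntegralCos.
Context {R : realType}.

Lemma sin_intmul (k : int) : sin (2 * pi * k%:~R) = 0 :> R /\ cos (2 * pi * k%:~R) = 1 :> R.
Proof.
have H n : sin (2 * pi * n%:R) = 0 :> R /\ cos (2 * pi * n%:R) = 1 :> R.
  elim: n => [|n [IHs IHc]]; first by rewrite mulr0 sin0 cos0.
  have -> : 2 * pi * n.+1%:R = 2 * pi * n%:R + pi *+ 2 :> R.
    by rewrite mulr2n -natr1; ring.
  by rewrite sinD2pi cosD2pi.
case: k => n; first exact: H.
by rewrite NegzE mulrNz mulrN sinN cosN; have [-> ->] := H n.+1; rewrite oppr0.
Qed.

Lemma cos_add_int (k : int) (t : R) : cos (t + 2 * pi * k%:~R) = cos t.
Proof. by rewrite cosD (sin_intmul k).1 (sin_intmul k).2 mulr1 mulr0 subr0. Qed.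

Lemma continuous_cos_affine (a t : R) : continuous (fun x => cos (a * x + t)).
Proof.
move=> x; apply: continuous_comp; last exact: continuous_cos.
apply: continuousD; last exact: cst_continuous.
by apply: continuousM; first exact: cst_continuous.
Qed.

(** Moves to Lebesgue measure on the closed interval, where the fundamental theorem of calculus
    applies: the complement of [0,1) is null for [circle_measure], and the endpoint 1 is null for
    Lebesgue measure. *)
Lemma integral_circle (f : R -> R) : continuous f -> (exists M, forall x, `|f x| <= M) ->
  (\int[circle_measure]_x (f x)%:E = \int[lebesgue_measure]_(x in `[0%R, 1%R]) (f x)%:E)%E.
Proof.
move=> cf [M fM].
have mf : measurable_fun setT f by exact: continuous_measurable_fun.
have intf : (@circle_measure R).-integrable setT (EFin \o f).
  apply: measurable_bounded_integrable => //.
    by rewrite /= /circle_measure /mrestr setTI lebesgue_measure_itv/= lte01 sube0 ltry.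
  exists M; split; first exact: num_real.
  by move=> N MN x _ /=; rewrite (le_trans (fM x))// ltW.
have mI : measurable (`[0%R, 1%R[ : set (measurableTypeR R)) by exact: measurable_itv.
have N0 : circle_measure (~` `[0%R, 1%R[ : set (measurableTypeR R)) = 0%E.
  by rewrite /circle_measure /mrestr setICl measure0.
rewrite (negligible_integral (measurableC mI) (@measurableT _ (measurableTypeR R)) intf N0).
rewrite setTD setCK -integral_itv_bndo_bndc//; last first.
  by apply/measurable_EFinP; apply: measurable_funTS.
apply: eq_measure_integral => A mA AI; rewrite /= /circle_measure /mrestr.
by congr (lebesgue_measure _); apply/setIidl.
Qed.

Lemma integral_circle_cos (k : int) (t : R) :
  (\int[circle_measure]_x (cos (2 * pi * k%:~R * x + t))%:E =
   (if k == 0 then cos t else 0)%:E)%E.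
Proof.
rewrite integral_circle; [|exact: continuous_cos_affine|by exists 1 => x; exact: cos_max].
have [->|k0] := eqVneq k 0.
  under eq_integral do rewrite mulr0 mul0r add0r.
  rewrite integral_cst//= lebesgue_measure_itv/= lte01 sube0.
  by rewrite mule1.
set a : R := 2 * pi * k%:~R.
have a0 : a != 0 by rewrite !mulf_neq0 ?intr_eq0 ?pnatr_eq0// gt_eqF// pi_gt0.
pose F : R -> R := a^-1 \*: (sin \o (fun x => a * x + t)).
have dF (x : R) : is_derive x 1 F (cos (a * x + t)).
  have d1 : is_derive x 1 (fun x : R => a * x + t) a.
    by apply: is_derive_eq; rewrite scaler1 addr0 ?scaler0 ?add0r.
  have d2 := @is_derive1_comp R sin (fun x => a * x + t) x _ _ (is_derive_sin _) d1.
  have d3 := is_deriveZ a^-1 d2.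
  by apply: is_derive_eq; rewrite /GRing.scale /= mulrCA mulVf ?mulr1.
have cF (x : R) : {for x, continuous F}.
  by apply: differentiable_continuous; apply/derivable1_diffP; exact: ex_derive.
rewrite (@continuous_FTC2 _ _ F)//.
- rewrite -EFinB; congr EFin; rewrite /F /= mulr1 mulr0 add0r -mulrBr (addrC a).
  by rewrite [sin (t + a)]sinD (sin_intmul k).1 (sin_intmul k).2 mulr1 mulr0 addr0 subrr mulr0.
- by apply: continuous_subspaceT; exact: continuous_cos_affine.
- split => [x _||]; first exact: ex_derive.
    by apply: cvg_at_right_filter; exact: cF.
  by apply: cvg_at_left_filter; exact: cF.
- by move=> x _; rewrite derive1E; exact: derive_val.
Qed.
End IntegralCos.

Section TorusIntegral.
Context {R : realType}.
Local Notation mu d := (torus_measure R d).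

Definition phase d (k : d.-tuple int) (x : d.-tuple R) : R :=
  2 * pi * \sum_(j < d) (tnth k j)%:~R * tnth x j.

(** A class closed under sums and products whose members are all integrable on the torus, so that
    one predicate discharges the integrability side conditions. *)
Definition bounded_measurable d (f : d.-tuple R -> R) :=
  measurable_fun setT f /\ exists M, forall x, `|f x| <= M.

Lemma bounded_measurable_integrable d (f : d.-tuple R -> R) :
  bounded_measurable f -> (mu d).-integrable setT (EFin \o f).
Proof.
move=> [mf [M fM]]; apply: measurable_bounded_integrable => //.
  exact: le_lt_trans (probability_le1 (mu d) measurableT) (ltry 1).
exists M; split; first exact: num_real.
by move=> N MN x _ /=; rewrite (le_trans (fM x))// ltW.
Qed.

Lemma measurable_phase d (k : d.-tuple int) : measurable_fun setT (phase k).
Proof.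
apply: measurable_funM => //; apply: measurable_sum => j.
by apply: measurable_funM => //; exact: measurable_tnth.
Qed.

Lemma bounded_measurable_cos d (k : d.-tuple int) (t : R) :
  bounded_measurable (fun x => cos (phase k x + t)).
Proof.
split; last by exists 1 => x; exact: cos_max.
apply: measurableT_comp; first by apply: continuous_measurable_fun; exact: continuous_cos.
by apply: measurable_funD => //; exact: measurable_phase.
Qed.

(** Induction on [d] by Fubini. The free shift [t] makes this possible: the first coordinate is
    integrated with the phase of the others absorbed into the shift. It also covers sines, through
    shifts by [pi / 2]. *)
Lemma Rintegral_cos_phase d (k : d.-tuple int) (t : R) :
  \int[mu d]_x cos (phase k x + t) = if [forall j, tnth k j == 0] then cos t else 0.
Proof.
rewrite /Rintegral; suff -> : (\int[mu d]_x (cos (phase k x + t))%:E)%E =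
    (if [forall j, tnth k j == 0] then cos t else 0)%:E by [].
elim: d k t => [|d IH] k t.
  rewrite /= integral_dirac//; last first.
    by apply/measurable_EFinP; exact: (bounded_measurable_cos k t).1.
  rewrite diracT mul1e /phase big_ord0 mulr0 add0r.
  by case: ifPn => // /forallPn[[]].
rewrite /=.
set f := fun x : d.+1.-tuple R => (cos (phase k x + t))%:E.
have mf : measurable_fun setT f.
  by apply/measurable_EFinP; exact: (bounded_measurable_cos k t).1.
have If : (circle_measure \x mu d)%E.-integrable setT (f \o tuple_cons).
  apply: measurable_bounded_integrable => //.
  - exact: le_lt_trans (probability_le1 (circle_measure \x mu d)%E measurableT) (ltry 1).
  - apply: measurableT_comp (bounded_measurable_cos k t).1 _.
    exact: measurable_funPT.
  - exists 1; split; first exact: num_real.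
    by move=> N N1 x _ /=; rewrite (le_trans (cos_max _))// ltW.
rewrite integral_distribution// -integral21_prod_meas1//.
set k' := [tuple of behead k].
have phE x y : phase k (tuple_cons (x, y)) = 2 * pi * (thead k)%:~R * x + phase k' y.
  rewrite /phase big_ord_recl mulrDr mulrA; congr (_ + _ * _).
  by apply: eq_bigr => j _; rewrite (tuple_eta k) !tnthS.
transitivity (\int[mu d]_y (if thead k == 0 then cos (phase k' y + t) else 0)%:E)%E.
  apply: eq_integral => y _; rewrite /f /=.
  rewrite /fubini_G -integral_circle_cos; apply: eq_integral => x _.
  by rewrite /= phE addrA.
have -> : [forall j, tnth k j == 0] = (thead k == 0) && [forall j, tnth k' j == 0].
  apply/forallP/andP => [k0|[k0 /forallP k'0] j].
    split; first exact: k0.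
    by apply/forallP => j; rewrite -(tnthS (thead k)) -tuple_eta; exact: k0.
  by case: (unliftP ord0 j) => [i|] ->//; rewrite (tuple_eta k) tnthS.
by case: (thead k == 0); [rewrite andTb; exact: IH|rewrite andFb integral0].
Qed.

End TorusIntegral.

(** * Complex exponentials and the one-dimensional kernel *)

Section Cexpi.
Context {R : realType}.
Implicit Types (z : R[i]) (t : R).

Definition sqnorm z : R := complex.Re z ^+ 2 + complex.Im z ^+ 2.

Lemma sqr_normc z : Normc.normc z ^+ 2 = sqnorm z.
Proof. by case: z => a b; rewrite /= sqr_sqrtr// addr_ge0// sqr_ge0. Qed.

Lemma sqnorm_ge0 z : 0 <= sqnorm z.
Proof. by rewrite addr_ge0// sqr_ge0. Qed.

Lemma sqnormM z1 z2 : sqnorm (z1 * z2) = sqnorm z1 * sqnorm z2.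
Proof. by case: z1 z2 => a b [a' b']; rewrite /sqnorm /=; ring. Qed.

Lemma sqnormB_le z1 z2 : sqnorm (z1 - z2) <= 2 * (sqnorm z1 + sqnorm z2).
Proof.
case: z1 z2 => a b [a' b']; rewrite /sqnorm /=.
by have := sqr_ge0 (a + a'); have := sqr_ge0 (b + b'); rewrite !expr2; lra.
Qed.

Lemma complex_ReM z1 z2 : complex.Re (z1 * z2) =
  complex.Re z1 * complex.Re z2 - complex.Im z1 * complex.Im z2.
Proof. by case: z1 z2 => a b []. Qed.

Lemma complex_ImM z1 z2 : complex.Im (z1 * z2) =
  complex.Re z1 * complex.Im z2 + complex.Im z1 * complex.Re z2.
Proof. by case: z1 z2 => a b []. Qed.

Lemma cexpiD t1 t2 : cexpi (t1 + t2) = cexpi t1 * cexpi t2.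
Proof.
apply/eqP; rewrite eq_complex complex_ReM complex_ImM /= cosD sinD.
by rewrite eqxx /= addrC eqxx.
Qed.

Lemma cexpi0 : cexpi 0 = 1 :> R[i].
Proof. by rewrite /cexpi cos0 sin0. Qed.

Lemma cexpi_natmul n t : cexpi (n%:R * t) = cexpi t ^+ n.
Proof.
elim: n => [|n IH]; first by rewrite mul0r cexpi0.
by rewrite -natr1 mulrDl mul1r cexpiD IH exprSr.
Qed.

Lemma sqnorm_cexpi t : sqnorm (cexpi t) = 1.
Proof. by rewrite /sqnorm /= cos2Dsin2. Qed.

Lemma cexpi_sum (I : Type) (r : seq I) (F : I -> R) :
  cexpi (\sum_(i <- r) F i) = \prod_(i <- r) cexpi (F i).
Proof. exact: (big_morph _ cexpiD cexpi0). Qed.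

(* The kernel ((2 + 2 cos t)/4)^N, rescaled to have mean one. *)
Definition kern1 (N : nat) t : R := (2 + 2 * cos t) ^+ N / 'C(N.*2, N)%:R.

(** Since e^(-it) (1 + e^(it))^2 = 2 + 2 cos t, the N-th power expands by the binomial theorem for
    the exponent 2N, shifted by N frequencies. *)
Lemma kern1E N t : \sum_(i < N.*2.+1)
    ('C(N.*2, i)%:R / 'C(N.*2, N)%:R)%:C * cexpi ((i%:Z - N%:Z)%:~R * t) =
  (kern1 N t)%:C.
Proof.
have base : cexpi (- t) * (1 + cexpi t) ^+ 2 = (2 + 2 * cos t)%:C.
  have s2 := sin2cos2 t.
  apply/eqP; rewrite eq_complex expr2 !complex_ReM !complex_ImM /= cosN sinN.
  apply/andP; split; apply/eqP.
    transitivity (cos t * ((1 + cos t) ^+ 2 - sin t ^+ 2) + 2 * sin t ^+ 2 * (1 + cos t)).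
      by ring.
    by rewrite s2; ring.
  transitivity (sin t * (cos t * 2 * (1 + cos t) - (1 + cos t) ^+ 2 + sin t ^+ 2)).
    by ring.
  by rewrite s2; ring.
rewrite /kern1 rmorphM rmorphXn /= -base exprMn -exprM mul2n.
rewrite exprDn mulr_sumr mulr_suml; apply: eq_bigr => i _.
rewrite intrB mulrBl -mulrN cexpiD !cexpi_natmul expr1n mul1r.
by rewrite rmorphM rmorph_nat -mulr_natl; ring.
Qed.

End Cexpi.

(** * Boxes of frequencies and the summation kernel *)

Section Box.
Variable d : nat.

(** Coordinates are ordinals shifted by [N], so that sums of products over the cube factor by
    distributivity, see [prod_box_sum]. *)
Definition box (N : nat) : seq (d.-tuple int) :=
  [seq [tuple (f j : nat)%:Z - N%:Z | j < d] | f : {ffun 'I_d -> 'I_N.*2.+1}].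

Lemma mem_box N k : (k \in box N) = [forall j, (`|tnth k j| <= N)%N].
Proof.
apply/mapP/forallP => [[f _ ->] j|kN].
  by rewrite tnth_mktuple; move: (f j) => [m /= mN]; lia.
exists [ffun j => inord (absz (tnth k j + N%:Z))]; first exact: mem_enum.
apply: eq_from_tnth => j; rewrite tnth_mktuple ffunE inordK; move: (tnth k j) (kN j) => z zN; lia.
Qed.

Lemma uniq_box N : uniq (box N).
Proof.
rewrite map_inj_uniq ?enum_uniq// => f g /(congr1 (fun u => tnth u)) fg.
apply/ffunP => j; apply/val_inj.
by have := congr1 (@^~ j) fg; rewrite !tnth_mktuple => /addIr [].
Qed.

Lemma perm_box N N' : (N <= N')%N ->
  perm_eq [seq k <- box N' | k \in box N] (box N).
Proof.
move=> NN'; apply: uniq_perm; rewrite ?filter_uniq ?uniq_box// => k.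
rewrite mem_filter andb_idr// !mem_box => /forallP kN; apply/forallP => j.
exact: leq_trans (kN j) NN'.
Qed.

Lemma prod_box_sum (T : comNzSemiRingType) N (F : 'I_d -> int -> T) :
  \sum_(k <- box N) \prod_(j < d) F j (tnth k j) =
  \prod_(j < d) \sum_(i < N.*2.+1) F j (i%:Z - N%:Z).
Proof.
rewrite bigA_distr_bigA big_map /= big_enum /=; apply: eq_bigr => f _.
by apply: eq_bigr => j _; rewrite tnth_mktuple.
Qed.

End Box.

(** * Calculus of bounded measurable functions on the torus *)

Section BoundedMeasurable.
Context {R : realType} {d : nat}.
Implicit Types f g : d.-tuple R -> R.
Local Notation mu := (torus_measure R d).

Lemma bounded_measurable_cst (c : R) :
  bounded_measurable (fun _ : d.-tuple R => c).
Proof. by split; [exact: measurable_cst|exists `|c|]. Qed.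

Lemma bounded_measurableD f g : bounded_measurable f -> bounded_measurable g ->
  bounded_measurable (fun x => f x + g x).
Proof.
move=> [mf [M fM]] [mg [N gN]]; split; first exact: measurable_funD.
by exists (M + N) => x; rewrite (le_trans (ler_normD _ _))// lerD.
Qed.

Lemma bounded_measurableM f g : bounded_measurable f -> bounded_measurable g ->
  bounded_measurable (fun x => f x * g x).
Proof.
move=> [mf [M fM]] [mg [N gN]]; split; first exact: measurable_funM.
by exists (M * N) => x; rewrite normrM ler_pM.
Qed.

Lemma bounded_measurable_sum (I : Type) (r : seq I) (F : I -> d.-tuple R -> R) :
  (forall i, bounded_measurable (F i)) ->
  bounded_measurable (fun x => \sum_(i <- r) F i x).
Proof.
move=> bF; elim: r => [|i r IH].
  by under eq_fun do rewrite big_nil; exact: bounded_measurable_cst.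
by under eq_fun do rewrite big_cons; exact: bounded_measurableD.
Qed.

Lemma bounded_measurableB f g : bounded_measurable f -> bounded_measurable g ->
  bounded_measurable (fun x => f x - g x).
Proof.
move=> bf bg; have := bounded_measurableD bf
  (bounded_measurableM (bounded_measurable_cst (-1)) bg).
by under eq_fun do rewrite mulN1r.
Qed.

Lemma bounded_measurable_norm f : bounded_measurable f ->
  bounded_measurable (fun x => `|f x|).
Proof.
move=> [mf [M fM]]; split; first exact: measurableT_comp.
by exists M => x; rewrite normr_id.
Qed.

Lemma torus_RintegralD f g : bounded_measurable f -> bounded_measurable g ->
  \int[mu]_x (f x + g x) = \int[mu]_x f x + \int[mu]_x g x.
Proof. by move=> bf bg; rewrite RintegralD//; exact: bounded_measurable_integrable. Qed.

Lemma torus_RintegralB f g : bounded_measurable f -> bounded_measurable g ->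
  \int[mu]_x (f x - g x) = \int[mu]_x f x - \int[mu]_x g x.
Proof. by move=> bf bg; rewrite RintegralB//; exact: bounded_measurable_integrable. Qed.

Lemma torus_RintegralZ (c : R) f : bounded_measurable f ->
  \int[mu]_x (c * f x) = c * \int[mu]_x f x.
Proof. by move=> bf; rewrite RintegralZl//; exact: bounded_measurable_integrable. Qed.

Lemma torus_Rintegral_cst (c : R) : \int[mu]_x c = c.
Proof.
rewrite Rintegral_cst// (_ : (_ : {measure set _ -> \bar R}) setT = 1%E) ?mulr1//.
exact: probability_setT.
Qed.

Lemma torus_Rintegral_sum (I : Type) (r : seq I) (F : I -> d.-tuple R -> R) :
  (forall i, bounded_measurable (F i)) ->
  \int[mu]_x (\sum_(i <- r) F i x) = \sum_(i <- r) \int[mu]_x F i x.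
Proof.
move=> bF; elim: r => [|i r IH].
  rewrite big_nil -[RHS](torus_Rintegral_cst 0).
  by apply: eq_Rintegral => x _; rewrite big_nil.
rewrite big_cons -IH -torus_RintegralD//; last exact: bounded_measurable_sum.
by apply: eq_Rintegral => x _; rewrite big_cons.
Qed.

Lemma le_torus_Rintegral f g : bounded_measurable f -> bounded_measurable g ->
  (forall x, f x <= g x) -> \int[mu]_x f x <= \int[mu]_x g x.
Proof.
by move=> bf bg fg; apply: le_Rintegral => //; exact: bounded_measurable_integrable.
Qed.

End BoundedMeasurable.

(** * Geometric decay beats polynomial growth *)

Section PolynomialGeometric.
Context {R : realType}.

(** Bernoulli's inequality for [q^-1 = 1 + e] makes the inverse power grow at least linearly. *)
Lemma linear_geometric_bounded (q : R) : 0 <= q < 1 ->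
  exists C, forall N : nat, (N.*2.+1)%:R * q ^+ N <= C.
Proof.
move=> /andP[q0 q1]; have [->|qn0] := eqVneq q 0.
  exists 1 => -[|N]; first by rewrite expr0 mulr1.
  by rewrite expr0n mulr0.
have {q0 qn0} q0 : 0 < q by rewrite lt_def qn0.
set e : R := q^-1 - 1; have e0 : 0 < e by rewrite subr_gt0 invf_gt1.
exists (2 / e + 1) => N.
have bern : 1 + N%:R * e <= q^-1 ^+ N.
  have -> : q^-1 = 1 + e by rewrite /e; ring.
  elim: N => [|N IH]; first by rewrite mul0r addr0.
  rewrite exprSr (le_trans _ (ler_wpM2r _ IH))//; last by lra.
  rewrite -natr1; have : 0 <= N%:R * e * e by rewrite !mulr_ge0// ltW.
  by lra.
have h : N.*2.+1%:R <= (2 / e + 1) * (q^-1) ^+ N :> R.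
  rewrite (le_trans _ (ler_wpM2l _ bern))//; last by rewrite addr_ge0// divr_ge0// ltW.
  have -> : (2 / e + 1) * (1 + N%:R * e) = 2 / e + 1 + 2 * N%:R + N%:R * e :> R.
    by field; rewrite gt_eqF.
  rewrite -natr1 -mul2n natrM.
  have : 0 <= N%:R * e by rewrite mulr_ge0// ltW.
  have : 0 <= 2 / e by rewrite divr_ge0// ltW.
  lra.
rewrite (le_trans (ler_wpM2r _ h)) ?exprn_ge0 ?(ltW q0)//.
by rewrite -mulrA -exprMn mulVf ?gt_eqF// expr1n mulr1.
Qed.

(** Induction on [m]: with [r] midway between [q] and 1, one linear factor is absorbed by the powers
    of [q / r], and the induction hypothesis is used at [r]. *)
Lemma poly_geometric_cvg0 (m : nat) (q : R) : 0 <= q < 1 ->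
  (fun N : nat => (N.*2.+1)%:R ^+ m * q ^+ N) @ \oo --> 0.
Proof.
elim: m q => [|m IH] q /andP[q0 q1].
  under eq_fun do rewrite expr0 mul1r.
  by apply: cvg_expr; rewrite ger0_norm.
set r : R := (1 + q) / 2.
have qr : q < r by rewrite /r; lra.
have r0 : 0 < r by rewrite /r; lra.
have r1 : r < 1 by rewrite /r; lra.
have [|C HC] := @linear_geometric_bounded (q / r).
  by rewrite divr_ge0 ?(ltW r0)//= ltr_pdivrMr// mul1r.
have lim : (fun N : nat => C * ((N.*2.+1)%:R ^+ m * r ^+ N)) @ \oo --> 0.
  rewrite -[X in _ --> X](mulr0 C); apply: cvgM; first exact: cvg_cst.
  by apply: IH; rewrite (ltW r0).
apply: squeeze_cvgr lim; last exact: cvg_cst.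
near=> N; apply/andP; split; first by rewrite mulr_ge0 ?exprn_ge0.
have -> : q ^+ N = (q / r) ^+ N * r ^+ N by rewrite -exprMn divfK ?gt_eqF.
have -> : N.*2.+1%:R ^+ m.+1 * ((q / r) ^+ N * r ^+ N) =
    N.*2.+1%:R * (q / r) ^+ N * (N.*2.+1%:R ^+ m * r ^+ N).
  by rewrite exprS; ring.
rewrite ler_wpM2r//.
by rewrite mulr_ge0 ?exprn_ge0 ?(ltW r0).
Unshelve. all: by end_near.
Qed.

End PolynomialGeometric.

(** The ratio of consecutive coefficients shows that they increase up to the middle ([H]); symmetry
    handles the other half. *)
Lemma bin_central_max (n k : nat) : ('C(n.*2, k) <= 'C(n.*2, n))%N.
Proof.
have H m : (m <= n)%N -> ('C(n.*2, n - m) <= 'C(n.*2, n))%N.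
  elim: m => [|m IH] mn; first by rewrite subn0.
  apply: leq_trans (IH (ltnW mn)).
  have E := mul_bin_left n.*2 (n - m.+1).
  have S : (n - m.+1).+1 = (n - m)%N by lia.
  rewrite S in E.
  rewrite -(@leq_pmul2l (n - m)); last by lia.
  by rewrite E leq_mul2r; apply/orP; right; lia.
have [kn|nk] := leqP k n; first by rewrite -(subKn kn) H// leq_subr.
have [k2n|/bin_small->//] := leqP k n.*2.
rewrite -bin_sub// (_ : n.*2 - k = n - (k - n))%N; last by lia.
by apply: H; lia.
Qed.

(** * The product kernel as an approximate identity *)

Section Kernel.
Context {R : realType} {d : nat}.
Implicit Types (x y : d.-tuple R) (k : d.-tuple int).
Local Notation mu := (torus_measure R d).

(** The Fourier coefficient of [kern1 N] when |k| <= N. For k < -N the absolute value produces a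
    meaningless number, still between 0 and 1; the sums below stay inside [box d N]. *)
Definition kappa1 (N : nat) (k : int) : R :=
  'C(N.*2, absz (k + N%:Z))%:R / 'C(N.*2, N)%:R.

Definition kappa (N : nat) k : R := \prod_(j < d) kappa1 N (tnth k j).

Definition kern (N : nat) x y : R :=
  \prod_(j < d) kern1 N (2 * pi * (tnth x j - tnth y j)).

Lemma bin_central_gt0 N : 0 < 'C(N.*2, N)%:R :> R.
Proof. by rewrite ltr0n bin_gt0 -addnn leq_addr. Qed.

Lemma kappa1_ge0 N (k : int) : 0 <= kappa1 N k.
Proof. by rewrite divr_ge0. Qed.

Lemma kappa_ge0 N k : 0 <= kappa N k.
Proof. by rewrite prodr_ge0 // => j _; exact: kappa1_ge0. Qed.

Lemma kappa_le1 N k : kappa N k <= 1.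
Proof.
suff : kappa N k <= \prod_(j < d) 1 by rewrite big1_eq.
apply: ler_prod => j _.
rewrite kappa1_ge0/= ler_pdivrMr ?bin_central_gt0// mul1r ler_nat.
exact: bin_central_max.
Qed.

Lemma phaseE k x : phase k x = \sum_(j < d) (tnth k j)%:~R * (2 * pi * tnth x j).
Proof. by rewrite /phase mulr_sumr; apply: eq_bigr => j _; rewrite mulrCA. Qed.

Lemma kernE N x y : \sum_(k <- box d N)
    (kappa N k)%:C * (cexpi (phase k x) * cexpi (- phase k y)) = (kern N x y)%:C.
Proof.
rewrite /kern rmorph_prod /=; under [RHS]eq_bigr do rewrite -kern1E.
have := prod_box_sum N (fun j (z : int) => (kappa1 N z)%:C *
  cexpi (z%:~R * (2 * pi * (tnth x j - tnth y j))) : R[i]).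
move=> E; rewrite (eq_bigr (fun k : d.-tuple int => \prod_(j < d)
  ((kappa1 N (tnth k j))%:C *
   cexpi ((tnth k j)%:~R * (2 * pi * (tnth x j - tnth y j)))))); last first.
  move=> k _; rewrite big_split /= -rmorph_prod; congr (_ * _).
  rewrite -cexpi_sum -cexpiD !phaseE -sumrB; congr cexpi.
  by apply: eq_bigr => j _; ring.
rewrite E; apply: eq_bigr => j _; apply: eq_bigr => i _.
by rewrite /kappa1 subrK absz_nat.
Qed.

Lemma kern_cosE N x y :
  kern N x y = \sum_(k <- box d N) kappa N k * cos (phase k y + - phase k x).
Proof.
have := congr1 (@complex.Re R) (kernE N x y) => /= <-.
rewrite raddf_sum; apply: eq_bigr => k _.
rewrite -cexpiD [LHS]complex_ReM /= mul0r subr0; congr (_ * _).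
by rewrite -cosN opprD opprK addrC.
Qed.

Lemma kern1_ge0 N (t : R) : 0 <= kern1 N t.
Proof.
rewrite divr_ge0// exprn_ge0//; have := cos_geN1 t; lra.
Qed.

Lemma kern_ge0 N x y : 0 <= kern N x y.
Proof. by rewrite prodr_ge0 // => j _; exact: kern1_ge0. Qed.

(** The 2N+1 binomial coefficients sum to 4^N and none exceeds the central one. *)
Lemma bin_central_ge N : 4 ^+ N <= N.*2.+1%:R * 'C(N.*2, N)%:R :> R.
Proof.
rewrite -natrX -natrM ler_nat.
have -> : (4 ^ N = (1 + 1) ^ N.*2)%N by rewrite -mul2n expnM.
rewrite expnDn; under eq_bigr do rewrite !exp1n !muln1.
rewrite -[X in (_ <= X * _)%N]card_ord -sum_nat_const.
by apply: leq_sum => i _; exact: bin_central_max.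
Qed.

Lemma kern1_le N (t q : R) : cos t <= 2 * q - 1 -> kern1 N t <= N.*2.+1%:R * q ^+ N.
Proof.
move=> tq; rewrite ler_pdivrMr ?bin_central_gt0//.
have c0 : 0 <= 2 + 2 * cos t by have := cos_geN1 t; lra.
have : (2 + 2 * cos t) ^+ N <= (4 * q) ^+ N by rewrite lerXn2r ?nnegrE//; lra.
move=> /le_trans; apply; rewrite exprMn mulrAC ler_wpM2r ?bin_central_ge//.
by rewrite exprn_ge0//; lra.
Qed.

(** One coordinate in which the points are far apart supplies the decay [q ^+ N]. Each remaining
    factor is at most 2N+1, by [kern1_le] with [q = 1]. *)
Lemma kern_le N x y (j : 'I_d) (q : R) :
  cos (2 * pi * (tnth x j - tnth y j)) <= 2 * q - 1 ->
  kern N x y <= N.*2.+1%:R ^+ d * q ^+ N.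
Proof.
move=> cq; rewrite /kern (bigD1 j)//=.
have q0 : 0 <= q by have := cos_geN1 (2 * pi * (tnth x j - tnth y j)); lra.
have -> : N.*2.+1%:R ^+ d * q ^+ N =
    (N.*2.+1%:R * q ^+ N) * \prod_(i < d | i != j) N.*2.+1%:R :> R.
  rewrite mulrAC; congr (_ * _); rewrite -(bigD1 j (P := xpredT))//=.
  by rewrite prodr_const card_ord.
rewrite ler_pM ?kern1_ge0 ?prodr_ge0 ?kern1_le// => [i _|]; first exact: kern1_ge0.
apply: ler_prod => i _; rewrite kern1_ge0/=.
apply: le_trans (kern1_le (q := 1) _ _) _.
  by have := cos_le1 (2 * pi * (tnth x i - tnth y i)); lra.
by rewrite expr1n mulr1.
Qed.

Lemma bounded_measurable_kern N x : bounded_measurable (kern N x).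
Proof.
rewrite (_ : kern N x = fun y => \sum_(k <- box d N)
   kappa N k * cos (phase k y + - phase k x)); last by apply/funext => y; exact: kern_cosE.
apply: bounded_measurable_sum => k; apply: bounded_measurableM.
  exact: bounded_measurable_cst.
exact: bounded_measurable_cos.
Qed.

(** Only the zero frequency survives integration, and its coefficient is normalised to 1. *)
Lemma Rintegral_kern N x : \int[mu]_y kern N x y = 1.
Proof.
under eq_Rintegral do rewrite kern_cosE.
rewrite torus_Rintegral_sum; last first.
  move=> k; apply: bounded_measurableM; first exact: bounded_measurable_cst.
  exact: bounded_measurable_cos.
under eq_bigr => k _.
  rewrite torus_RintegralZ; last exact: bounded_measurable_cos.
  rewrite Rintegral_cos_phase; over.
set k0 : d.-tuple int := [tuple 0 | j < d].
rewrite (bigD1_seq k0) ?uniq_box//=; last first.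
  by rewrite mem_box; apply/forallP => j; rewrite tnth_mktuple.
rewrite big1 ?addr0 => [|k kk0]; last first.
  case: ifPn => [/forallP kE|_]; last by rewrite mulr0.
  case/eqP: kk0; apply: eq_from_tnth => j; rewrite tnth_mktuple; exact/eqP.
rewrite ifT; last by apply/forallP => j; rewrite tnth_mktuple.
rewrite phaseE big1 => [|j _]; last by rewrite tnth_mktuple mul0r.
rewrite oppr0 cos0 mulr1 /kappa big1// => j _.
by rewrite tnth_mktuple /kappa1 add0r absz_nat divff// gt_eqF ?bin_central_gt0.
Qed.

(** The usual approximate identity argument. Where [a y] is close to [a x], the kernel's unit mass
    bounds the error by [e]; elsewhere some coordinate is far on the circle and [kern_le] gives
    uniform decay. The cosine measures distance modulo integers, so no fundamental domain has to be
    chosen. *)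
Lemma kern_approx (a : d.-tuple R -> R) x : bounded_measurable a ->
  (forall e, 0 < e -> exists2 q, 0 <= q < 1 & forall y, `|a y - a x| <= e \/
     exists j, cos (2 * pi * (tnth x j - tnth y j)) <= 2 * q - 1) ->
  (fun N => \int[mu]_y (a y * kern N x y)) @ \oo --> a x.
Proof.
move=> ba loc; have [M aM] := ba.2.
have M0 : 0 <= M by rewrite (le_trans _ (aM x)).
apply/cvgrPdist_le => e e0.
have [|q q01 near_or_far] := loc (e / 2); first by rewrite divr_gt0.
have q0 : 0 <= q by case/andP: q01.
have lim : (fun N : nat => 2 * M * (N.*2.+1%:R ^+ d * q ^+ N)) @ \oo --> 0.
  rewrite -[X in _ --> X](mulr0 (2 * M)); apply: cvgM; first exact: cvg_cst.
  exact: poly_geometric_cvg0.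
have /cvgrPdist_le/(_ (e / 2)) := lim.
rewrite divr_gt0// => /(_ isT); apply: filterS => N.
rewrite sub0r normrN ger0_norm => [small|]; last by rewrite !mulr_ge0// exprn_ge0.
have bK := bounded_measurable_kern N x.
have bc := @bounded_measurable_cst R d.
have -> : a x - \int[mu]_y (a y * kern N x y) = \int[mu]_y ((a x - a y) * kern N x y).
  rewrite -[X in X - _]mulr1 -(Rintegral_kern N x) -torus_RintegralZ//.
  rewrite -torus_RintegralB; [|exact: bounded_measurableM..].
  by apply: eq_Rintegral => y _; rewrite mulrBl.
have bD : bounded_measurable (fun y => (a x - a y) * kern N x y).
  by apply: bounded_measurableM => //; exact: bounded_measurableB.
apply: le_trans (le_normr_Rintegral _ (bounded_measurable_integrable bD)) _ => //.
apply: (@le_trans _ _ (\int[mu]_y (e / 2 * kern N x y + 2 * M * (N.*2.+1%:R ^+ d * q ^+ N)))).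
  apply: le_torus_Rintegral.
  - exact: bounded_measurable_norm.
  - by apply: bounded_measurableD => //; exact: bounded_measurableM.
  move=> y; rewrite normrM (ger0_norm (kern_ge0 N x y)).
  have K0 := kern_ge0 N x y.
  have P0 : 0 <= N.*2.+1%:R ^+ d * q ^+ N :> R by rewrite mulr_ge0 ?exprn_ge0.
  have [ae|[j cq]] := near_or_far y.
    by rewrite distrC ler_wpDr ?ler_wpM2r// (mulr_ge0 _ P0)// mulr_ge0.
  rewrite ler_wpDl ?mulr_ge0 ?divr_ge0 ?(ltW e0)//.
  rewrite ler_pM ?kern_le//; last exact: kern_le cq.
  by rewrite mulr_natl mulr2n (le_trans (ler_normB _ _))// lerD.
rewrite torus_RintegralD//; last exact: bounded_measurableM.
rewrite torus_RintegralZ// Rintegral_kern torus_Rintegral_cst; lra.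
Qed.

Lemma kern_average_le (a : d.-tuple R -> R) (M : R) N x : bounded_measurable a ->
  (forall y, `|a y| <= M) -> `|\int[mu]_y (a y * kern N x y)| <= M.
Proof.
move=> ba aM; have bK := bounded_measurable_kern N x.
have bD : bounded_measurable (fun y => a y * kern N x y) by exact: bounded_measurableM.
apply: le_trans (le_normr_Rintegral _ (bounded_measurable_integrable bD)) _ => //.
rewrite -[leRHS]mulr1 -(Rintegral_kern N x) -torus_RintegralZ//.
apply: le_torus_Rintegral => [||y]; first exact: bounded_measurable_norm.
  by apply: bounded_measurableM => //; exact: bounded_measurable_cst.
by rewrite normrM (ger0_norm (kern_ge0 N x y)) ler_wpM2r ?kern_ge0.
Qed.

End Kernel.

(** * Continuous periodic functions *)

Section TorusContinuous.
Context {R : realType} {d : nat}.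
Implicit Types (x y : d.-tuple R) (a : d.-tuple R -> R).

Definition tuple_of_row (v : 'rV[R]_d) : d.-tuple R := [tuple v ord0 j | j < d].

Definition periodicR a := forall (k : d.-tuple int) x,
  a [tuple tnth x j + (tnth k j)%:~R | j < d] = a x.

Definition torus_continuousR a := periodicR a /\ continuous (a \o tuple_of_row).

Lemma torus_continuousR_ball a x e : torus_continuousR a -> 0 < e ->
  exists2 del, 0 < del & forall y,
    (forall j, `|tnth x j - tnth y j| < del) -> `|a x - a y| < e.
Proof.
move=> [_ ca] e0; pose v : 'rV[R]_d := \row_j tnth x j.
have tv : tuple_of_row v = x by apply: eq_from_tnth => j; rewrite tnth_mktuple mxE.
have /cvgrPdist_lt/(_ e e0) := ca v.
rewrite -nbhs_nearE => /nbhs_ballP[del /= del0 H].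
exists del => // y xy; pose w : 'rV[R]_d := \row_j tnth y j.
have tw : tuple_of_row w = y by apply: eq_from_tnth => j; rewrite tnth_mktuple mxE.
have := H w; rewrite /= tv tw; apply.
by split=> // i j; rewrite !mxE; exact: xy.
Qed.

(** Compactness of the closed unit cube of row vectors, to which every point is brought by
    periodicity. *)
Lemma torus_continuousR_bounded a : torus_continuousR a ->
  exists M, forall x, `|a x| <= M.
Proof.
move=> [pa ca].
have cA := @rV_compact R d (fun=> `[0%R, 1%R]%classic) (fun=> @segment_compact R 0 1).
have /compact_bounded [M [_ HM]] := continuous_compact (continuous_subspaceT ca) cA.
exists (M + 1) => x.
pose k := [tuple - Num.floor (tnth x j) | j < d].
rewrite -(pa k x); set y := [tuple _ | _ < d].
apply: (HM (M + 1)); first by rewrite ltrDl.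
exists (\row_j tnth y j); last first.
  by rewrite /=; congr a; apply: eq_from_tnth => j; rewrite tnth_mktuple mxE.
move=> j; rewrite /= mxE in_itv/= !tnth_mktuple mulrNz.
by have /andP[] := floor_itv (tnth x j); rewrite intrD; lra.
Qed.

(** A step function on a grid: each cell is a finite intersection of measurable coordinate strips,
    and there are countably many cells. It serves to prove continuous functions measurable for the
    product sigma-algebra of tuples. *)
Lemma measurable_fun_discretize (F : d.-tuple int -> R) (n : nat) :
  measurable_fun setT (fun y => F [tuple Num.floor (n.+1%:R * tnth y j) | j < d]).
Proof.
move=> _ Y mY; rewrite setTI.
pose cell (k : d.-tuple int) : set (d.-tuple R) :=
  \bigcap_(j in [set: 'I_d]) [set y | Num.floor (n.+1%:R * tnth y j) = tnth k j].
have mcell k : measurable (cell k).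
  apply: fin_bigcap_measurable => [|j _]; first exact: finite_finset.
  rewrite (_ : [set _ | _] = (fun y => n.+1%:R * tnth y j) @^-1`
     `[(tnth k j)%:~R, (tnth k j + 1)%:~R[).
    rewrite -[X in measurable X]setTI.
    have mf : measurable_fun setT (fun y : d.-tuple R => n.+1%:R * tnth y j).
      by apply: measurable_funM => //; exact: measurable_tnth.
    by apply: mf => //; exact: measurable_itv.
  apply/seteqP; split => y /=; rewrite in_itv/=.
    by move=> <-; exact: floor_itv.
  by move=> /floor_def.
rewrite (_ : _ @^-1` _ = \bigcup_(k in [set: d.-tuple int])
    (if `[< Y (F k) >] then cell k else set0)).
  apply: countable_bigcupT_measurable => [|k]; first exact: countableP.
  by case: ifPn.
apply/seteqP; split => y /=.
  move=> Yy; exists [tuple Num.floor (n.+1%:R * tnth y j) | j < d] => //.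
  by case: asboolP => // _ j _; rewrite /= tnth_mktuple.
move=> [k _]; case: asboolP => // Yk cy.
rewrite (_ : [tuple _ | _ < _] = k)//; apply: eq_from_tnth => j.
by rewrite tnth_mktuple; exact: cy.
Qed.

(** A continuous function is the pointwise limit of its values at the lower corners of grid cells of
    side [1 / n.+1]. *)
Lemma torus_continuousR_measurable a : torus_continuousR a -> measurable_fun setT a.
Proof.
move=> ca; pose grid n (k : d.-tuple int) : d.-tuple R :=
  [tuple (tnth k j)%:~R / n.+1%:R | j < d].
apply: (@measurable_fun_cvg _ _ _ _ (fun n y =>
    a (grid n [tuple Num.floor (n.+1%:R * tnth y j) | j < d]))) => [n|x _].
  exact: (measurable_fun_discretize (fun k => a (grid n k)) n).
apply/cvgrPdist_lt => e e0.
have [del del0 H] := torus_continuousR_ball x ca e0.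
near=> n; apply: H => j; rewrite !tnth_mktuple.
have n0 : 0 < n.+1%:R :> R by [].
have /andP[f1 f2] := floor_itv (n.+1%:R * tnth x j).
have -> : tnth x j - (Num.floor (n.+1%:R * tnth x j))%:~R / n.+1%:R =
  (n.+1%:R * tnth x j - (Num.floor (n.+1%:R * tnth x j))%:~R) / n.+1%:R.
  by field; rewrite addrC natr1 gt_eqF.
rewrite ger0_norm; last by rewrite divr_ge0// subr_ge0.
rewrite ltr_pdivrMr//; apply: (@le_lt_trans _ _ 1).
  by move: f2; rewrite intrD; lra.
rewrite mulrC -ltr_pdivrMl// mulr1.
by near: n; exact: (near_infty_natSinv_lt (PosNum del0)).
Unshelve. all: by end_near.
Qed.

Lemma torus_continuousR_bounded_measurable a :
  torus_continuousR a -> bounded_measurable a.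
Proof.
by move=> ca; split; [exact: torus_continuousR_measurable|exact: torus_continuousR_bounded].
Qed.

Lemma torus_continuousR_kern a x : torus_continuousR a ->
  (fun N => \int[torus_measure R d]_y (a y * kern N x y)) @ \oo --> a x.
Proof.
move=> ca; apply: kern_approx; first exact: torus_continuousR_bounded_measurable.
move=> e e0; have [del' del0' H] := torus_continuousR_ball x ca e0.
(* Capped at 1/2 so that [2 * pi * del] stays in [0, pi], where the cosine decreases. *)
set del := Num.min del' (1 / 2).
have del0 : 0 < del by rewrite lt_min del0'/= divr_gt0.
have del1 : del <= 1 / 2 by rewrite ge_min lexx orbT.
have pi0 := pi_gt0 R.
have pidel : 2 * pi * del <= pi.
  rewrite -[leRHS](_ : 2 * pi * (1 / 2) = pi :> R); last by field.
  by rewrite ler_pM2l// mulr_gt0.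
have pd0 : 0 < 2 * pi * del by rewrite !mulr_gt0.
have Id : 2 * pi * del \in `[0, pi] by rewrite in_itv/= (ltW pd0).
have c1 : cos (2 * pi * del) < 1.
  by rewrite -[ltRHS](cos0 R) ltr_cos// in_itv/= lexx ltW.
(* Chosen so that [2 * q - 1] is [cos (2 * pi * del)]. *)
exists ((1 + cos (2 * pi * del)) / 2).
  by have := cos_geN1 (2 * pi * del); lra.
(* [z] is the integer translate of [y] with every coordinate within 1/2 of that of [x]. If it is not
   within [del] of [x], the offending coordinate is the far one. *)
move=> y; pose m j := Num.floor (tnth x j - tnth y j + 1 / 2).
pose z := [tuple tnth y j + (m j)%:~R | j < d].
have az : a z = a y.
  rewrite -(ca.1 [tuple m j | j < d] y); congr a; apply: eq_from_tnth => j.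
  by rewrite !tnth_mktuple.
have [near|] := pselect (forall j, `|tnth x j - tnth z j| < del).
  left; rewrite -az distrC ltW// H// => j.
  by rewrite (lt_le_trans (near j))// ge_min lexx.
move=> /existsNP[j /negP]; rewrite -leNgt => far; right; exists j.
set u := tnth x j - tnth z j in far *.
have uE : tnth x j - tnth y j = u + (m j)%:~R.
  by rewrite /u tnth_mktuple; ring.
have uh : `|u| <= 1 / 2.
  have /andP[] := floor_itv (tnth x j - tnth y j + 1 / 2).
  rewrite -/(m j) uE intrD ler_norml; lra.
rewrite uE mulrDr cos_add_int.
have -> : cos (2 * pi * u) = cos (2 * pi * `|u|).
  rewrite -(cos_norm (2 * pi * u)) !normrM (ger0_norm (ltW pi0)).
  by rewrite ger0_norm.
have u2 : 2 * pi * `|u| <= pi.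
  rewrite -[leRHS](_ : 2 * pi * (1 / 2) = pi :> R); last by field.
  by rewrite ler_pM2l// mulr_gt0.
have Iu : 2 * pi * `|u| \in `[0, pi] by rewrite in_itv/= u2 !mulr_ge0// ltW.
have : cos (2 * pi * `|u|) <= cos (2 * pi * del).
  by rewrite leNgt ltr_cos// -leNgt ler_pM2l// mulr_gt0.
lra.
Qed.

End TorusContinuous.

(** * Complex integrals and Parseval for trigonometric polynomials *)

Section ComplexIntegral.
Context {R : realType} {d : nat}.
Implicit Types (F G h : d.-tuple R -> R[i]) (z : R[i]) (x y : d.-tuple R).
Implicit Types (k : d.-tuple int) (s : seq (d.-tuple int)) (c : d.-tuple int -> R[i]).
Local Notation mu := (torus_measure R d).

Definition cbounded_measurable F :=
  bounded_measurable (fun x => complex.Re (F x)) /\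
  bounded_measurable (fun x => complex.Im (F x)).

Lemma cbounded_measurableM F G : cbounded_measurable F -> cbounded_measurable G ->
  cbounded_measurable (fun x => F x * G x).
Proof.
move=> [rF iF] [rG iG]; split.
  under eq_fun do rewrite complex_ReM.
  by apply: bounded_measurableB; exact: bounded_measurableM.
under eq_fun do rewrite complex_ImM.
by apply: bounded_measurableD; exact: bounded_measurableM.
Qed.

Lemma cbounded_measurable_cst z : cbounded_measurable (fun _ => z).
Proof. by split; exact: bounded_measurable_cst. Qed.

Lemma cbounded_measurable_sum (I : Type) (r : seq I) (F : I -> d.-tuple R -> R[i]) :
  (forall i, cbounded_measurable (F i)) ->
  cbounded_measurable (fun x => \sum_(i <- r) F i x).
Proof.
move=> bF; split.
  under eq_fun do rewrite raddf_sum.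
  by apply: bounded_measurable_sum => i; exact: (bF i).1.
under eq_fun do rewrite raddf_sum.
by apply: bounded_measurable_sum => i; exact: (bF i).2.
Qed.

Lemma cbounded_measurable_cexpi k (t : R) :
  cbounded_measurable (fun x => cexpi (phase k x + t)).
Proof.
split; first exact: bounded_measurable_cos.
rewrite (_ : (fun x => _) = fun x => cos (phase k x + (t - pi / 2))).
  exact: bounded_measurable_cos.
by apply/funext => x; rewrite addrA cosBpihalf.
Qed.

Lemma cbounded_measurable_cexpiN k :
  cbounded_measurable (fun x => cexpi (- phase k x)).
Proof.
pose k' := [tuple - tnth k j | j < d].
have := cbounded_measurable_cexpi k' 0.
rewrite (_ : (fun x => cexpi (phase k' x + 0)) = fun x => cexpi (- phase k x))//.
apply/funext => x; rewrite addr0 /phase -mulrN -sumrN; congr (cexpi (_ * _)).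
by apply: eq_bigr => j _; rewrite tnth_mktuple mulrNz mulNr.
Qed.

Lemma cintegralZ z F : cbounded_measurable F ->
  cintegral (fun x => z * F x) = z * cintegral F.
Proof.
move=> [rF iF]; have bZ (a : R) f : bounded_measurable f ->
    bounded_measurable (fun x : d.-tuple R => a * f x).
  by move=> bf; apply: bounded_measurableM => //; exact: bounded_measurable_cst.
apply/eqP; rewrite eq_complex complex_ReM complex_ImM /=; apply/andP; split; apply/eqP.
  under eq_Rintegral do rewrite complex_ReM.
  by rewrite torus_RintegralB ?torus_RintegralZ//; exact: bZ.
under eq_Rintegral do rewrite complex_ImM.
by rewrite torus_RintegralD ?torus_RintegralZ//; exact: bZ.
Qed.

Lemma cintegral_sum (I : Type) (r : seq I) (F : I -> d.-tuple R -> R[i]) :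
  (forall i, cbounded_measurable (F i)) ->
  cintegral (fun x => \sum_(i <- r) F i x) = \sum_(i <- r) cintegral (F i).
Proof.
move=> bF; apply/eqP; rewrite eq_complex !raddf_sum /=; apply/andP; split; apply/eqP.
  under eq_Rintegral do rewrite raddf_sum.
  by rewrite torus_Rintegral_sum// => i; exact: (bF i).1.
under eq_Rintegral do rewrite raddf_sum.
by rewrite torus_Rintegral_sum// => i; exact: (bF i).2.
Qed.

Definition trigpoly s c x : R[i] := \sum_(k <- s) c k * cexpi (phase k x).

Lemma cbounded_measurable_trigpoly s c : cbounded_measurable (trigpoly s c).
Proof.
apply: cbounded_measurable_sum => k; apply: cbounded_measurableM.
  exact: cbounded_measurable_cst.
have := cbounded_measurable_cexpi k 0.
by under eq_fun do rewrite addr0.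
Qed.

Lemma bounded_measurable_sqnorm F : cbounded_measurable F ->
  bounded_measurable (fun x => sqnorm (F x)).
Proof.
by move=> [rF iF]; apply: bounded_measurableD; exact: bounded_measurableM.
Qed.

Lemma Rintegral_cos_phaseB k l (t : R) :
  \int[mu]_x cos (phase k x - phase l x + t) = if k == l then cos t else 0.
Proof.
pose m := [tuple tnth k j - tnth l j | j < d].
under eq_Rintegral => x _.
  have -> : phase k x - phase l x = phase m x.
    rewrite /phase -mulrBr -sumrB; congr (_ * _); apply: eq_bigr => j _.
    by rewrite tnth_mktuple intrB mulrBl.
  over.
rewrite Rintegral_cos_phase; congr (if _ then _ else _).
apply/forallP/eqP => [H|kl j]; last by rewrite tnth_mktuple kl subrr.
apply: eq_from_tnth => j; apply/eqP; rewrite -subr_eq0.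
by have := H j; rewrite tnth_mktuple.
Qed.

Lemma bounded_measurable_cosB k l (t : R) :
  bounded_measurable (fun x : d.-tuple R => cos (phase k x - phase l x + t)).
Proof.
have [r1 i1] := cbounded_measurable_cexpi k t.
have [r2 i2] := cbounded_measurable_cexpi l 0.
rewrite (_ : (fun x => _) = fun x => cos (phase k x + t) * cos (phase l x + 0) +
  sin (phase k x + t) * sin (phase l x + 0)).
  by apply: bounded_measurableD; exact: bounded_measurableM.
by apply/funext => x; rewrite addr0 -cosB addrAC.
Qed.

Lemma parseval_trigpoly s c : uniq s ->
  \int[mu]_x sqnorm (trigpoly s c x) = \sum_(k <- s) sqnorm (c k).
Proof.
move=> us.
(* [A k l] is the real part, and [B k l] minus the imaginary part, of c_k times the conjugate of
   c_l. In [E] the sine is written as a cosine shifted by [pi / 2], so one orthogonality lemma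
   suffices. *)
pose A k l := complex.Re (c k) * complex.Re (c l) + complex.Im (c k) * complex.Im (c l).
pose B k l := complex.Re (c k) * complex.Im (c l) - complex.Im (c k) * complex.Re (c l).
have bcos := bounded_measurable_cosB.
have bZ (a : R) f : bounded_measurable f ->
    bounded_measurable (fun x : d.-tuple R => a * f x).
  by move=> bf; apply: bounded_measurableM => //; exact: bounded_measurable_cst.
have E x : sqnorm (trigpoly s c x) = \sum_(k <- s) \sum_(l <- s)
    (A k l * cos (phase k x - phase l x + 0) + B k l * cos (phase k x - phase l x - pi / 2)).
  rewrite /sqnorm /trigpoly !raddf_sum !expr2 !mulr_suml -big_split /=.
  apply: eq_bigr => k _; rewrite !mulr_sumr -big_split /=; apply: eq_bigr => l _.
  rewrite !complex_ReM !complex_ImM /= addr0 cosBpihalf cosB sinB /A /B; ring.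
under eq_Rintegral do rewrite E.
rewrite torus_Rintegral_sum; last first.
  move=> k; apply: bounded_measurable_sum => l.
  by apply: bounded_measurableD; exact: bZ.
apply: eq_big_seq => k ks.
rewrite torus_Rintegral_sum; last first.
  by move=> l; apply: bounded_measurableD; exact: bZ.
rewrite (bigD1_seq k)//= big1 => [|l lk].
  rewrite torus_RintegralD ?torus_RintegralZ//; [|exact: bZ..].
  rewrite !Rintegral_cos_phaseB eqxx cos0 cosN cos_pihalf /A /sqnorm; ring.
rewrite torus_RintegralD ?torus_RintegralZ//; [|exact: bZ..].
by rewrite !Rintegral_cos_phaseB eq_sym (negPf lk) !mulr0 addr0.
Qed.

End ComplexIntegral.

(** * Summability means of continuous functions *)

Section FejerSums.
Context {R : realType} {d : nat}.
Implicit Types (h : d.-tuple R -> R[i]) (x y : d.-tuple R).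
Local Notation mu := (torus_measure R d).

Lemma normc_ge_Re (z : R[i]) : `|complex.Re z| <= Normc.normc z.
Proof.
rewrite -sqrtr_sqr; case: z => a b /=; rewrite ler_wsqrtr//.
by rewrite lerDl sqr_ge0.
Qed.

Lemma normc_ge_Im (z : R[i]) : `|complex.Im z| <= Normc.normc z.
Proof.
rewrite -sqrtr_sqr; case: z => a b /=; rewrite ler_wsqrtr//.
by rewrite lerDr sqr_ge0.
Qed.

Lemma continuous_ReIm (T : topologicalType) (g : T -> R[i]^o) : continuous g ->
  continuous (fun v => complex.Re (g v)) /\ continuous (fun v => complex.Im (g v)).
Proof.
move=> cg.
have H v (e : R) : 0 < e -> \forall w \near v, Normc.normc (g v - g w) < e.
  move=> e0; have /cvgrPdist_lt/(_ e%:C) := cg v.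
  rewrite ltcR => /(_ e0); apply: filterS => w H; rewrite -ltcR; exact: H.
split=> v; apply/cvgrPdist_lt => e e0; have := H v e e0; apply: filterS => w;
  apply: le_lt_trans.
  by have := normc_ge_Re (g v - g w); rewrite raddfB.
by have := normc_ge_Im (g v - g w); rewrite raddfB.
Qed.

Lemma torus_continuous_ReIm h : torus_continuous h ->
  torus_continuousR (fun x => complex.Re (h x)) /\
  torus_continuousR (fun x => complex.Im (h x)).
Proof.
move=> [ph ch]; have [cr ci] := continuous_ReIm ch.
by split; split=> // k x; rewrite ph.
Qed.

Lemma torus_continuous_cbounded h : torus_continuous h -> cbounded_measurable h.
Proof.
by move/torus_continuous_ReIm => [cr ci]; split; exact: torus_continuousR_bounded_measurable.
Qed.

(** The convolution of [h] with [kern N], given by its Fourier multipliers. As 2 + 2 cos t = 4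
    cos^2(t/2), this is the tensor product of de la Vallee Poussin's kernels; it is positive, as
    Fejer's is, and its multipliers lie in [0,1]. *)
Definition fejer N h : d.-tuple R -> R[i] :=
  trigpoly (box d N) (fun k => (kappa N k)%:C * fourier_coef h k).

Lemma fejerE N h x : cbounded_measurable h ->
  fejer N h x = cintegral (fun y => h y * (kern N x y)%:C).
Proof.
move=> bh.
have bk k : cbounded_measurable (fun y => h y * cexpi (- phase k y)).
  by apply: cbounded_measurableM => //; exact: cbounded_measurable_cexpiN.
rewrite /fejer /trigpoly.
transitivity (\sum_(k <- box d N) cintegral (fun y =>
   (kappa N k)%:C * cexpi (phase k x) * (h y * cexpi (- phase k y)))).
  apply: eq_bigr => k _; rewrite (cintegralZ _ (bk k)).
  by rewrite mulrAC.
rewrite -cintegral_sum; last first.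
  move=> k; apply: cbounded_measurableM; last exact: bk.
  exact: cbounded_measurable_cst.
congr cintegral; apply/funext => y; rewrite -kernE mulr_sumr.
by apply: eq_bigr => k _; ring.
Qed.

Lemma fejer_ReIm N h x : cbounded_measurable h ->
  complex.Re (fejer N h x) = \int[mu]_y (complex.Re (h y) * kern N x y) /\
  complex.Im (fejer N h x) = \int[mu]_y (complex.Im (h y) * kern N x y).
Proof.
move=> bh; rewrite fejerE//=; split; apply: eq_Rintegral => y _.
  by rewrite complex_ReM /= mulr0 subr0.
by rewrite complex_ImM /= mulr0 add0r.
Qed.

Lemma fejer_sqnorm_cvg h x : torus_continuous h ->
  (fun N => sqnorm (fejer N h x)) @ \oo --> sqnorm (h x).
Proof.
move=> ch; have [cr ci] := torus_continuous_ReIm ch.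
have bh := torus_continuous_cbounded ch.
under eq_fun do rewrite /sqnorm (fejer_ReIm _ _ bh).1 (fejer_ReIm _ _ bh).2 !expr2.
rewrite /sqnorm !expr2.
by apply: cvgD; apply: cvgM; exact: torus_continuousR_kern.
Qed.

Lemma fejer_sqnorm_bounded h : torus_continuous h ->
  exists M, forall N x, sqnorm (fejer N h x) <= M.
Proof.
move=> ch; have bh := torus_continuous_cbounded ch.
have [[br [M1 H1]] [bi [M2 H2]]] := bh.
exists (M1 ^+ 2 + M2 ^+ 2) => N x.
rewrite /sqnorm (fejer_ReIm _ _ bh).1 (fejer_ReIm _ _ bh).2.
have sqle (u M : R) : `|u| <= M -> u ^+ 2 <= M ^+ 2.
  by move=> uM; rewrite -[leLHS]real_normK ?num_real// lerXn2r ?nnegrE// (le_trans _ uM).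
by apply: lerD; apply: sqle; apply: kern_average_le => //; [exact: bh.1|exact: bh.2].
Qed.

(** Parseval is applied only to the polynomials [fejer N h]; the passage to [h] is dominated
    convergence, with pointwise convergence and the uniform bound from the two preceding lemmas. *)
Lemma fejer_norm_cvg h : torus_continuous h ->
  (fun N => \sum_(k <- box d N) sqnorm ((kappa N k)%:C * fourier_coef h k)) @ \oo -->
  \int[mu]_x sqnorm (h x).
Proof.
move=> ch; have bh := torus_continuous_cbounded ch.
have [M HM] := fejer_sqnorm_bounded ch.
have bf N : bounded_measurable (fun x => sqnorm (fejer N h x)).
  by apply: bounded_measurable_sqnorm; exact: cbounded_measurable_trigpoly.
have bs := bounded_measurable_sqnorm bh.
under eq_fun => N do rewrite -parseval_trigpoly ?uniq_box//.
apply: fine_cvg; rewrite fineK; last first.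
  by apply: integrable_fin_num => //; exact: bounded_measurable_integrable.
have mT := @measurableT _ (d.-tuple R).
have [] := @dominated_convergence _ _ _ mu setT mT
  (fun N x => (sqnorm (fejer N h x))%:E) (fun x => (sqnorm (h x))%:E) (fun=> M%:E).
- by move=> N; apply/measurable_EFinP; exact: (bf N).1.
- by apply/measurable_EFinP; exact: bs.1.
- by apply: aeW => x _; apply: cvg_EFin; [exact: nearW|exact: fejer_sqnorm_cvg].
- by apply: bounded_measurable_integrable; exact: bounded_measurable_cst.
- by apply: aeW => x N _ /=; rewrite lee_fin ger0_norm ?sqnorm_ge0.
by move=> _ _.
Qed.

Lemma L2_normE h : cbounded_measurable h ->
  L2_norm h = (Num.sqrt (\int[mu]_x sqnorm (h x)))%:E.
Proof.
move=> bh; have bs := bounded_measurable_sqnorm bh.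
rewrite /L2_norm unlock /=.
under eq_integral => x _.
  rewrite ger0_norm ?(le_trans (normr_ge0 _) (normc_ge_Re _))//.
  rewrite (powR_mulrn 2) ?(le_trans (normr_ge0 _) (normc_ge_Re _))// sqr_normc.
  over.
rewrite -[X in (X `^ _)%E](@fineK _ (\int[mu]_x (sqnorm (h x))%:E)%E); last first.
  by apply: integrable_fin_num => //; exact: bounded_measurable_integrable.
by rewrite poweR_EFin powR12_sqrt// Rintegral_ge0// => x _; exact: sqnorm_ge0.
Qed.

(** The limit in [N] of an inequality between polynomials. The means converge at each sample point
    to the value of [h] there, which is zero, so the term with [B] disappears. *)
Lemma L2_norm_le_sampling h (A B : R) m (xs : 'I_m -> d.-tuple R) :
  torus_continuous h -> (forall i, h (xs i) = 0) ->
  (\forall N \near \oo,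
     \sum_(k <- box d N) sqnorm ((kappa N k)%:C * fourier_coef h k) <=
     A + B * \sum_i sqnorm (fejer N h (xs i))) ->
  (L2_norm h <= (Num.sqrt A)%:E)%E.
Proof.
move=> ch h0 le; rewrite L2_normE; last exact: torus_continuous_cbounded.
rewrite lee_fin ler_wsqrtr//.
have lim : (fun N => A + B * \sum_i sqnorm (fejer N h (xs i))) @ \oo --> A.
  rewrite -[X in _ --> X]addr0; apply: cvgD; first exact: cvg_cst.
  rewrite -[X in _ --> X](mulr0 B); apply: cvgM; first exact: cvg_cst.
  elim: (index_enum 'I_m) => [|i r IH].
    by under eq_fun do rewrite big_nil; exact: cvg_cst.
  have Hi : (fun N => sqnorm (fejer N h (xs i))) @ \oo --> 0.
    by have := @fejer_sqnorm_cvg h (xs i) ch; rewrite h0 {2}/sqnorm /= expr0n addr0.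
  have H0 := cvgD Hi IH; rewrite addr0 in H0.
  rewrite (_ : (fun N => \sum_(j <- i :: r) sqnorm (fejer N h (xs j))) = (fun N =>
    sqnorm (fejer N h (xs i)) + \sum_(j <- r) sqnorm (fejer N h (xs j)))).
    exact: H0.
  by apply/funext => N; rewrite big_cons.
exact: ler_cvg_to (fejer_norm_cvg ch) lim le.
Qed.

End FejerSums.

(** * Point selection for trigonometric polynomials *)

Section TrigSelection.
Context {R : realType} {d : nat}.
Implicit Types (x y : d.-tuple R) (k : d.-tuple int).
Implicit Types (c : d.-tuple int -> R[i]).
Local Notation mu := (torus_measure R d).

Section FixedSpectrum.
Variable s : seq (d.-tuple int).
Hypothesis us : uniq s.
Local Notation M := (size s).

(* The real space R^(2M) stands for C^M: the two halves of the index set are the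
   real and the imaginary parts of the coefficients. *)
Definition freq (a : 'I_(M + M)) : d.-tuple int :=
  tnth (in_tuple s) (match fintype.split a with inl i => i | inr i => i end).

Definition shift (a : 'I_(M + M)) : R :=
  match fintype.split a with inl _ => 0 | inr _ => pi / 2 end.

(* The flag selects the real or the imaginary part of the value at the point, see
   [dotr_sample_vector]. *)
Definition sample_vector (p : d.-tuple R * bool) : 'rV[R]_(M + M) :=
  \row_a cos (phase (freq a) p.1 + shift a - (if p.2 then 0 else pi / 2)).

Definition coef_vector c : 'rV[R]_(M + M) :=
  \row_a match fintype.split a with
         | inl i => complex.Re (c (tnth (in_tuple s) i))
         | inr i => complex.Im (c (tnth (in_tuple s) i))
         end.

Lemma split_lshiftE (i : 'I_M) : fintype.split (lshift M i) = inl i.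
Proof. exact: (unsplitK (inl i)). Qed.

Lemma split_rshiftE (i : 'I_M) : fintype.split (rshift M i) = inr i.
Proof. exact: (unsplitK (inr i)). Qed.

(** The two real coordinates of one frequency differ in phase by [pi / 2], and distinct frequencies
    are orthogonal. So the sample vectors, summed over the flag, have the identity as their mean
    outer product. *)
Lemma freq_shift_orth (a b : 'I_(M + M)) :
  (if freq a == freq b then cos (shift a - shift b) else 0) = (a == b)%:R :> R.
Proof.
have fE (i j : 'I_M) : (tnth (in_tuple s) i == tnth (in_tuple s) j) = (i == j).
  by apply/eqP/eqP => [|-> //]; exact: (tuple_uniqP (in_tuple s) us).
rewrite -(splitK a) -(splitK b) (can_eq (@unsplitK M M)).
rewrite /freq /shift !unsplitK.
case: (fintype.split a) (fintype.split b) => i [] j;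
  rewrite fE ?subrr ?cos0 ?subr0 ?sub0r ?cosN ?cos_pihalf.
- by rewrite (inj_eq (@inl_inj _ _)); case: (i == j).
- by case: ifP.
- by case: ifP.
- by rewrite (inj_eq (@inr_inj _ _)); case: (i == j).
Qed.

(** Adding the two flags turns products of cosines and sines into the cosine of a difference, and
    the sum integrates to [\tr Q]. If every value were below a quarter of the trace, the integral
    would be at most half of it. The quarter leaves room for the loss of strictness under
    integration. *)
Lemma sample_vector_mean (Q : 'M[R]_(M + M)) : 0 < \tr Q ->
  exists p, \tr Q / 4 <= qform Q (sample_vector p).
Proof.
move=> Q0; apply/not_existsP => small.
pose f x := qform Q (sample_vector (x, true)) + qform Q (sample_vector (x, false)).
have fE x : f x = \sum_a \sum_b Q b a *
    cos (phase (freq b) x - phase (freq a) x + (shift b - shift a)).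
  rewrite /f /qform !mxE -big_split /=; apply: eq_bigr => a _.
  rewrite !mxE !mulr_suml -big_split /=; apply: eq_bigr => b _.
  rewrite !mxE /= !subr0 !cosBpihalf.
  have -> : phase (freq b) x - phase (freq a) x + (shift b - shift a) =
    phase (freq b) x + shift b - (phase (freq a) x + shift a) by ring.
  by rewrite cosB; ring.
have bt (a b : 'I_(M + M)) : bounded_measurable (fun x : d.-tuple R => Q b a *
    cos (phase (freq b) x - phase (freq a) x + (shift b - shift a))).
  apply: bounded_measurableM; first exact: bounded_measurable_cst.
  exact: bounded_measurable_cosB.
have bf : bounded_measurable f.
  rewrite (funext fE); apply: bounded_measurable_sum => a.
  exact: bounded_measurable_sum.
have If : \int[mu]_x f x = \tr Q.
  rewrite (eq_Rintegral _ (fun x _ => fE x)) torus_Rintegral_sum; last first.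
    by move=> a; exact: bounded_measurable_sum.
  apply: eq_bigr => a _; rewrite torus_Rintegral_sum//.
  rewrite (bigD1 a)//= big1 ?addr0 => [|b ba].
    rewrite torus_RintegralZ; last exact: bounded_measurable_cosB.
    by rewrite Rintegral_cos_phaseB freq_shift_orth eqxx mulr1.
  rewrite torus_RintegralZ; last exact: bounded_measurable_cosB.
  by rewrite Rintegral_cos_phaseB freq_shift_orth (negPf ba) mulr0.
have : \int[mu]_x f x <= \int[mu]_x (\tr Q / 2).
  apply: le_torus_Rintegral => // [|x]; first exact: bounded_measurable_cst.
  have := small (x, true); have := small (x, false).
  by rewrite /f => /negP; rewrite -ltNge => ? /negP; rewrite -ltNge => ?; lra.
rewrite If torus_Rintegral_cst; lra.
Qed.

Lemma dotr_sample_vector c x b : dotr (sample_vector (x, b)) (coef_vector c) =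
  if b then complex.Re (trigpoly s c x) else complex.Im (trigpoly s c x).
Proof.
rewrite dotrE big_split_ord /= /trigpoly; case: b; rewrite raddf_sum [RHS]big_tnth -big_split /=;
  apply: eq_bigr => i _; rewrite !mxE /freq /shift split_lshiftE split_rshiftE /=.
- by rewrite !subr0 addr0 cosDpihalf [RHS]complex_ReM /=; ring.
- by rewrite addr0 addrK cosBpihalf [RHS]complex_ImM /=; ring.
Qed.

Lemma sum_coef_vector c (F : d.-tuple int -> R) :
  \sum_a F (freq a) * coef_vector c 0 a ^+ 2 = \sum_(k <- s) F k * sqnorm (c k).
Proof.
rewrite big_split_ord /= [RHS]big_tnth -big_split /=; apply: eq_bigr => i _.
by rewrite !mxE /freq split_lshiftE split_rshiftE -mulrDr.
Qed.

Lemma trig_selection (W : d.-tuple int -> R) (lam : R) (n : nat) :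
  (0 < M)%N -> (0 < n)%N -> 0 < lam -> (forall k, 0 < W k) ->
  \sum_(k <- s) (lam * W k + 1)^-1 <= n%:R / 16 ->
  exists xs : 'I_n -> d.-tuple R, forall c,
    \sum_(k <- s) sqnorm (c k) <= lam * (\sum_(k <- s) W k * sqnorm (c k)) +
      16 / n%:R * \sum_i sqnorm (trigpoly s c (xs i)).
Proof.
move=> M0 n0 lam0 W0 eff.
pose D : 'rV[R]_(M + M) := \row_a (lam * W (freq a) + 1).
have D0 a : 0 < lam * W (freq a) + 1 by rewrite addr_gt0// mulr_gt0.
have qD v : qform (diag_mx D) v = \sum_a (lam * W (freq a) + 1) * v 0 a ^+ 2.
  rewrite qformE dotrE; apply: eq_bigr => a _.
  by rewrite mul_mx_diag !mxE expr2; ring.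
have pD : posdef (diag_mx D).
  split=> [|v v0]; first exact: tr_diag_mx.
  apply: (@lt_le_trans _ _ (dotr v v)); first exact: dotr_gt0.
  rewrite qD dotrE ler_sum// => a _; rewrite -expr2 ler_peMl ?sqr_ge0//.
  by rewrite lerDr mulr_ge0// ltW.
have n0' : 0 < n%:R :> R by rewrite ltr0n.
(* Each frequency fills two real coordinates, so the trace is at most twice [n / 16]. With this
   [Phi], [n] steps subtract 2 in total: one unit cancels the identity inside [D], the other is the
   left side of the claim. *)
have Phi0 : 0 < n%:R / 8 :> R by rewrite divr_gt0.
have trD : \tr (invmx (diag_mx D)) <= n%:R / 8.
  have -> : invmx (diag_mx D) = diag_mx (\row_a (lam * W (freq a) + 1)^-1).
    have E : diag_mx D *m diag_mx (\row_a (lam * W (freq a) + 1)^-1) = 1%:M.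
      rewrite mulmx_diag; apply/matrixP => a b.
      by rewrite !mxE divff// gt_eqF.
    by rewrite -[LHS]mulmx1 -E mulKmx// (posdef_unit pD).
  rewrite mxtrace_diag big_split_ord /=.
  have := sum_coef_vector.
  under eq_bigr do rewrite mxE /freq split_lshiftE.
  under [X in _ + X <= _]eq_bigr do rewrite mxE /freq split_rshiftE.
  rewrite -(big_tnth _ _ s xpredT (fun k => (lam * W k + 1)^-1)); lra.
have M20 : (0 < M + M)%N by rewrite addn_gt0 M0.
have [f Hf] := barrier_selection M20 sample_vector_mean n Phi0 pD trD.
exists (fun i => (f i).1) => c; have := Hf (coef_vector c).
have -> : n%:R / (4 * (n%:R / 8)) = 2 :> R by field; rewrite gt_eqF.
have -> : 2 / (n%:R / 8) = 16 / n%:R :> R by field; rewrite gt_eqF.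
rewrite qD (sum_coef_vector c (fun k => lam * W k + 1)).
have -> : dotr (coef_vector c) (coef_vector c) = \sum_(k <- s) sqnorm (c k).
  have := sum_coef_vector c (fun=> 1); under [RHS]eq_bigr do rewrite mul1r.
  by rewrite dotrE => <-; apply: eq_bigr => a _; rewrite mul1r expr2.
have -> : \sum_(k <- s) (lam * W k + 1) * sqnorm (c k) =
    lam * (\sum_(k <- s) W k * sqnorm (c k)) + \sum_(k <- s) sqnorm (c k).
  by rewrite mulr_sumr -big_split /=; apply: eq_bigr => k _; ring.
(* The barrier selects only the real or the imaginary part at each point; the full modulus dominates
   it. *)
have : 16 / n%:R * \sum_i dotr (sample_vector (f i)) (coef_vector c) ^+ 2 <=
    16 / n%:R * \sum_i sqnorm (trigpoly s c (f i).1).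
  rewrite ler_wpM2l ?divr_ge0// ler_sum// => i _.
  rewrite (surjective_pairing (f i)) dotr_sample_vector /sqnorm /=.
  by case: ifP => _; rewrite ?lerDl ?lerDr sqr_ge0.
lra.
Qed.

End FixedSpectrum.

(** Weighted Cauchy-Schwarz, from a nonnegative weighted sum of squares of deviations of [z i / v i]
    from [X / E]. *)
Lemma sqr_sum_le (I : Type) (r : seq I) (P : pred I) (v z : I -> R) (E : R) : 0 < E ->
  (forall i, 0 < v i) -> \sum_(i <- r | P i) v i <= E ->
  (\sum_(i <- r | P i) z i) ^+ 2 <= E * \sum_(i <- r | P i) z i ^+ 2 / v i.
Proof.
move=> E0 v0 vE; set X := \sum_(i <- r | P i) z i; set T := \sum_(i <- r | P i) _ / _.
have expand t : \sum_(i <- r | P i) v i * (z i / v i - t) ^+ 2 =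
    T - 2 * t * X + t ^+ 2 * \sum_(i <- r | P i) v i.
  rewrite /T /X !mulr_sumr -sumrB -big_split /=; apply: eq_bigr => i _.
  by field; rewrite gt_eqF.
have : 0 <= \sum_(i <- r | P i) v i * (z i / v i - X / E) ^+ 2.
  by rewrite sumr_ge0// => i _; rewrite mulr_ge0 ?sqr_ge0 ?(ltW (v0 i)).
rewrite expand.
have : (X / E) ^+ 2 * (\sum_(i <- r | P i) v i) <= (X / E) ^+ 2 * E.
  by rewrite ler_wpM2l ?sqr_ge0.
have -> : (X / E) ^+ 2 * E = X ^+ 2 / E by field; rewrite gt_eqF.
have -> : 2 * (X / E) * X = 2 * (X ^+ 2 / E) by field; rewrite gt_eqF.
move=> h1 h2; rewrite mulrC -ler_pdivrMr//; lra.
Qed.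

Lemma sqnorm_sum_le (I : Type) (r : seq I) (P : pred I) (v : I -> R) (z : I -> R[i]) (E : R) :
  0 < E -> (forall i, 0 < v i) -> \sum_(i <- r | P i) v i <= E ->
  sqnorm (\sum_(i <- r | P i) z i) <= E * \sum_(i <- r | P i) sqnorm (z i) / v i.
Proof.
move=> E0 v0 vE; rewrite /sqnorm !raddf_sum /=.
under [X in _ <= E * X]eq_bigr do rewrite mulrDl.
by rewrite big_split mulrDr lerD// sqr_sum_le.
Qed.

Lemma summable_box_tail (V : d.-tuple int -> R) (B e : R) : (forall k, 0 < V k) ->
  (forall N, \sum_(k <- box d N) V k <= B) -> 0 < e ->
  exists N0, forall N, (N0 <= N)%N -> \sum_(k <- box d N | k \notin box d N0) V k <= e.
Proof.
move=> V0 VB e0; pose S N := \sum_(k <- box d N) V k.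
have SE N0 N : (N0 <= N)%N ->
    S N = S N0 + \sum_(k <- box d N | k \notin box d N0) V k.
  move=> NN; rewrite /S (bigID (fun k => k \in box d N0)) /=; congr (_ + _).
  by rewrite -big_filter; apply: perm_big; exact: perm_box.
have ndS : nondecreasing_seq S.
  by move=> N0 N NN; rewrite (SE _ _ NN) lerDl sumr_ge0// => k _; exact: ltW.
have cS : cvgn S.
  by apply: nondecreasing_is_cvgn => //; exists B => _ [N _ <-]; exact: VB.
have /cvgrPdist_le/(_ e e0)[N0 _ HN] := cS.
exists N0 => N NN.
have SL := nondecreasing_cvgn_le ndS cS N.
have := HN N0 (leqnn _); rewrite ger0_norm ?subr_ge0 ?nondecreasing_cvgn_le//.
have := SE _ _ NN; lra.
Qed.

(** The points are selected for one box [N0] and then serve every larger box. Summability of [1 / W]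
    makes the frequencies outside [N0] negligible, both in the norm and at the sample points. *)
Lemma trigpoly_sampling (W : d.-tuple int -> R) (lam B : R) (n : nat) :
  (0 < n)%N -> 0 < lam -> (forall k, 0 < W k) ->
  (forall N, \sum_(k <- box d N) (W k)^-1 <= B) ->
  (forall N, \sum_(k <- box d N) (lam * W k + 1)^-1 <= n%:R / 16) ->
  exists xs : 'I_n -> d.-tuple R, exists N0, forall N, (N0 <= N)%N -> forall c,
    \sum_(k <- box d N) sqnorm (c k) <=
      2 * lam * (\sum_(k <- box d N) W k * sqnorm (c k)) +
      32 / n%:R * \sum_i sqnorm (trigpoly (box d N) c (xs i)).
Proof.
move=> n0 lam0 W0 WB eff.
have V0 k : 0 < (W k)^-1 by rewrite invr_gt0.
(* The tail costs [32 * e * A1] through the sample values and [e * A1] through its own coefficients,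
   [lam * A1] altogether. *)
have e0 : 0 < lam / 33 by rewrite divr_gt0.
have [N0 tail] := summable_box_tail V0 WB e0; set e := lam / 33 in e0 tail.
have box0 : (0 < size (box d N0))%N.
  have : [tuple 0 | j < d] \in box d N0.
    by rewrite mem_box; apply/forallP => j; rewrite tnth_mktuple.
  by case: (box d N0).
have [xs Hxs] := trig_selection (uniq_box d N0) box0 n0 lam0 W0 (eff N0).
exists xs, N0 => N NN c.
have n0' : 0 < n%:R :> R by rewrite ltr0n.
have split_sum (T : nmodType) (F : d.-tuple int -> T) : \sum_(k <- box d N) F k =
    \sum_(k <- box d N0) F k + \sum_(k <- box d N | k \notin box d N0) F k.
  rewrite (bigID (fun k => k \in box d N0)) /=; congr (_ + _).
  by rewrite -big_filter; apply: perm_big; exact: perm_box.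
set A0 := \sum_(k <- box d N0) W k * sqnorm (c k).
set A1 := \sum_(k <- box d N | k \notin box d N0) W k * sqnorm (c k).
have A00 : 0 <= A0 by rewrite sumr_ge0// => k _; rewrite mulr_ge0 ?sqnorm_ge0 ?(ltW (W0 k)).
have A10 : 0 <= A1 by rewrite sumr_ge0// => k _; rewrite mulr_ge0 ?sqnorm_ge0 ?(ltW (W0 k)).
have tailN := tail N NN.
(* Cauchy-Schwarz with weights [1 / W] bounds the tail polynomial at a point, these weights having
   sum at most [e] over the tail. *)
have point x : sqnorm (trigpoly (box d N0) c x) <=
    2 * sqnorm (trigpoly (box d N) c x) + 2 * e * A1.
  have -> : trigpoly (box d N0) c x = trigpoly (box d N) c x -
      \sum_(k <- box d N | k \notin box d N0) c k * cexpi (phase k x).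
    by rewrite /trigpoly split_sum addrK.
  apply: le_trans (sqnormB_le _ _) _; rewrite mulrDr lerD2l -mulrA ler_pM2l//.
  apply: le_trans (sqnorm_sum_le _ e0 V0 tailN) _.
  rewrite ler_pM2l// ler_sum// => k _.
  by rewrite sqnormM sqnorm_cexpi mulr1 invrK mulrC.
(* A single [1 / W k] in the tail is at most the whole tail sum, hence at most [e]. *)
have tail2 : \sum_(k <- box d N | k \notin box d N0) sqnorm (c k) <= e * A1.
  rewrite mulr_sumr big_seq_cond [leRHS]big_seq_cond ler_sum// => k /andP[kN kN0].
  rewrite mulrA ler_peMl ?sqnorm_ge0// -ler_pdivrMr// mul1r.
  apply: le_trans tailN; rewrite (big_rem k)//= kN0 lerDl.
  by rewrite sumr_ge0// => l _; exact: ltW.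
rewrite !split_sum -/A0 -/A1.
have := Hxs c; rewrite -/A0.
set P := \sum_i sqnorm (trigpoly (box d N) c (xs i)).
have : 16 / n%:R * \sum_i sqnorm (trigpoly (box d N0) c (xs i)) <=
    32 / n%:R * P + 32 * e * A1.
  have : \sum_i sqnorm (trigpoly (box d N0) c (xs i)) <= 2 * P + n%:R * (2 * e * A1).
    rewrite /P mulr_sumr -[X in X%:R * _]card_ord mulr_natl -sumr_const -big_split /=.
    by apply: ler_sum => i _; exact: point.
  rewrite -(ler_pM2l (x := 16 / n%:R)) ?divr_gt0// => /le_trans; apply.
  rewrite le_eqVlt; apply/orP; left; apply/eqP; field; rewrite gt_eqF//.
have -> : lam = 33 * e by rewrite /e; field.
have : 0 <= e * A1 by rewrite mulr_ge0// ltW.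
have : 0 <= e * A0 by rewrite mulr_ge0// ltW.
lra.
Qed.

End TrigSelection.

(** * The effective dimension *)

Section PowerSums.
Context {R : realType}.
Implicit Types (a b c r rho u t : R).

(* Discrete form of  int u^(-rho-1) du = - u^(-rho) / rho. *)
Lemma powR_telescope u t rho : 0 < u -> 0 < t -> 0 < rho ->
  rho * t * (u + t) `^ (- (rho + 1)) <= u `^ (- rho) - (u + t) `^ (- rho).
Proof.
move=> u0 t0 rho0; set v := u + t.
have v0 : 0 < v by rewrite addr_gt0.
have -> : v `^ (- (rho + 1)) = v `^ (- rho) / v.
  rewrite opprD powRD; last by rewrite (gt_eqF v0) implybT.
  by rewrite (powRN v 1) powRr1// ltW.
have uv : u / v = 1 - t / v by rewrite /v; field; rewrite gt_eqF.
have uv0 : 0 < u / v by rewrite divr_gt0.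
have -> : u `^ (- rho) = v `^ (- rho) * (u / v) `^ (- rho).
  by rewrite -powRM ?(ltW v0) ?(ltW uv0)// mulrC divfK// gt_eqF.
have h : 1 + rho * (t / v) <= (u / v) `^ (- rho).
  rewrite /powR gt_eqF//; apply: le_trans (expR_ge1Dx _).
  rewrite lerD2l mulNr -mulrN ler_pM2l//.
  have := @le_ln1Dx R (- (t / v)); rewrite -uv => /(_ _).
  have -> : -1 < - (t / v) by move: uv0; rewrite uv; lra.
  by move=> /(_ isT); lra.
have P0 : 0 < v `^ (- rho) by rewrite powR_gt0.
have := ler_wpM2l (ltW P0) h.
have -> : rho * t * (v `^ (- rho) / v) = v `^ (- rho) * (rho * (t / v)) by ring.
rewrite mulrDr mulr1; lra.
Qed.

Lemma sum_powR_shift_le u t rho (m : nat) : 0 < u -> 0 < t -> 0 < rho ->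
  \sum_(k < m) (u + t *+ k.+1) `^ (- (rho + 1)) <= u `^ (- rho) / (rho * t).
Proof.
move=> u0 t0 rho0; rewrite ler_pdivlMr ?mulr_gt0// mulrC.
suff : rho * t * \sum_(k < m) (u + t *+ k.+1) `^ (- (rho + 1)) <=
    u `^ (- rho) - (u + t *+ m) `^ (- rho).
  by have := powR_ge0 (u + t *+ m) (- rho); lra.
elim: m => [|m IH]; first by rewrite big_ord0 mulr0 mulr0n addr0 subrr.
rewrite big_ord_recr /= mulrDr.
have um : 0 < u + t *+ m by rewrite ltr_pwDl// mulrn_wge0// ltW.
have := powR_telescope um t0 rho0.
by rewrite -addrA -mulrSr; lra.
Qed.

Lemma sum_powRN_le rho (m : nat) : 0 < rho ->
  \sum_(k < m) (k.+1)%:R `^ (- (rho + 1)) <= 1 + rho^-1 :> R.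
Proof.
move=> rho0; case: m => [|m].
  by rewrite big_ord0 addr_ge0// invr_ge0 ltW.
rewrite big_ord_recl powR1 lerD2l.
have := @sum_powR_shift_le 1 1 rho m ltr01 ltr01 rho0.
rewrite powR1 mulr1 mul1r; apply: le_trans; rewrite le_eqVlt; apply/orP; left.
by apply/eqP; apply: eq_bigr => k _; rewrite -mulrS.
Qed.

(** For [c <= 1] the 1 in the denominator is dropped, giving a multiple of c^a <= c^r. For [c > 1]
    each term is at most 2^a (1 + k/c)^(-a), whose sum telescopes to a multiple of c <= c^r. The
    freedom in [r] is what Rankin's trick exploits. *)
Lemma sum_decay_le a c r (m : nat) : 1 < a -> 0 < c -> 1 <= r <= a ->
  \sum_(k < m) (1 + (k.+1%:R / c) `^ a)^-1 <= (1 + (1 + 2 `^ a) / (a - 1)) * c `^ r.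
Proof.
move=> a1 c0 /andP[r1 ra]; have a10 : 0 < a - 1 by rewrite subr_gt0.
have aE : a - 1 + 1 = a by ring.
have P2 : 0 < 2 `^ a :> R by rewrite powR_gt0.
have D0 : 0 <= 2 `^ a / (a - 1) by rewrite divr_ge0// ltW.
have D1 : 0 <= (a - 1)^-1 by rewrite invr_ge0 ltW.
have KE : 1 + (1 + 2 `^ a) / (a - 1) = 1 + (a - 1)^-1 + 2 `^ a / (a - 1) :> R.
  by rewrite mulrDl mul1r addrA.
have [c1|c1] := leP c 1.
  apply: (@le_trans _ _ ((1 + (a - 1)^-1) * c `^ a)).
    have := sum_powRN_le m a10; rewrite aE => H.
    rewrite mulrC; apply: le_trans (ler_wpM2l (powR_ge0 c a) H).
    rewrite mulr_sumr ler_sum// => k _.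
    have k0 : 0 < k.+1%:R / c by rewrite divr_gt0.
    have -> : c `^ a * k.+1%:R `^ (- a) = ((k.+1%:R / c) `^ a)^-1.
      have E : k.+1%:R `^ a = (k.+1%:R / c) `^ a * c `^ a.
        by rewrite -powRM ?(ltW c0) ?(ltW k0)// divfK// gt_eqF.
      by rewrite powRN E; field; rewrite !gt_eqF// powR_gt0.
    by rewrite lef_pV2 ?posrE ?addr_gt0 ?powR_gt0// lerDr.
  rewrite ler_pM ?powR_ge0 ?addr_ge0// ?KE ?lerDl//.
  by apply: ger_powR => //; rewrite c0.
apply: (@le_trans _ _ (2 `^ a / (a - 1) * c)); last first.
  rewrite ler_pM ?(ltW c0)// ?KE ?lerDr ?addr_ge0//.
  rewrite -[leLHS]powRr1 ?(ltW c0)// ler_powR// ltW//.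
have ic0 : 0 < c^-1 by rewrite invr_gt0.
have := @sum_powR_shift_le 1 c^-1 (a - 1) m ltr01 ic0 a10.
rewrite powR1 mul1r invfM invrK aE => H.
rewrite -mulrA; apply: le_trans (ler_wpM2l (ltW P2) H).
rewrite mulr_sumr ler_sum// => k _.
set x := k.+1%:R / c; have x0 : 0 < x by rewrite divr_gt0.
have -> : 1 + c^-1 *+ k.+1 = 1 + x by rewrite -mulr_natl.
rewrite powRN -[X in X / _]invrK -invfM lef_pV2 ?posrE ?addr_gt0 ?powR_gt0//; last first.
  by rewrite mulr_gt0 ?invr_gt0 ?powR_gt0// addr_gt0.
rewrite mulrC ler_pdivrMr//.
have P1 : 0 < x `^ a by rewrite powR_gt0.
have [x1|x1] := leP x 1.
  apply: (@le_trans _ _ (2 `^ a)).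
    by apply: ge0_ler_powR; rewrite ?nnegrE//; lra.
  by rewrite ler_peMl ?(ltW P2)//; lra.
apply: (@le_trans _ _ ((2 * x) `^ a)).
  by apply: ge0_ler_powR; rewrite ?nnegrE//; lra.
rewrite powRM// ?(ltW x0)// mulrC ler_wpM2r ?(ltW P2)//; lra.
Qed.

(** The negative, zero and positive frequencies each contribute at most one copy of the sum; zero
    counts as [g 1] because of [maxn]. *)
Lemma symmetric_sum_le (g : nat -> R) (N : nat) : (forall k, 0 <= g k) ->
  \sum_(i < N.*2.+1) g (maxn 1 (absz (i%:Z - N%:Z))) <= 3 * \sum_(k < N.+1) g k.+1.
Proof.
move=> g0; pose G i := g (maxn 1 (absz (i%:Z - N%:Z))).
rewrite -(big_mkord xpredT G) (big_cat_nat (n := N)) //=; last by lia.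
have S0 : \sum_(k < N) g k.+1 <= \sum_(k < N.+1) g k.+1.
  by rewrite big_ord_recr lerDl.
have -> : \sum_(0 <= i < N) G i = \sum_(k < N) g k.+1.
  rewrite big_nat_rev big_mkord; apply: eq_bigr => k _; rewrite /G; congr g.
  by have := ltn_ord k; lia.
have -> : \sum_(N <= i < N.*2.+1) G i = g 1%N + \sum_(k < N) g k.+1.
  rewrite big_ltn; last by lia.
  congr (_ + _); first by rewrite /G subrr.
  rewrite -{1}[N.+1]add0n big_addn (_ : N.*2.+1 - N.+1 = N)%N; last by lia.
  by rewrite big_mkord; apply: eq_bigr => k _; rewrite /G; congr g; lia.
have : g 1%N <= \sum_(k < N.+1) g k.+1.
  by rewrite big_ord_recl lerDl sumr_ge0.
lra.
Qed.

End PowerSums.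

(** * Sums over boxes with hyperbolic cross weights *)

Section BoxSums.
Context {R : realType}.

Definition hz (z : int) : R := (maxn 1 (absz z))%:R.

(** Its sublevel sets are the hyperbolic crosses; its powers bound the weights of H^s_mix from
    below, see [mixed_weight_ge]. *)
Definition hmix d (k : d.-tuple int) : R := \prod_(j < d) hz (tnth k j).

Lemma hz_ge1 z : 1 <= hz z.
Proof. by rewrite ler1n leq_maxl. Qed.

Lemma hz_gt0 z : 0 < hz z.
Proof. exact: lt_le_trans (hz_ge1 z). Qed.

Lemma hmix_gt0 d (k : d.-tuple int) : 0 < hmix k.
Proof. by rewrite prodr_gt0// => j _; exact: hz_gt0. Qed.

Lemma hmix_powR d (k : d.-tuple int) (r : R) :
  hmix k `^ r = \prod_(j < d) hz (tnth k j) `^ r.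
Proof.
rewrite /hmix; elim: (index_enum 'I_d) => [|j l IH]; first by rewrite !big_nil powR1.
rewrite !big_cons powRM ?IH ?(ltW (hz_gt0 _))//.
by rewrite prodr_ge0// => i _; rewrite ltW ?hz_gt0.
Qed.

Lemma box_cons_sum d N (F : d.+1.-tuple int -> R) :
  \sum_(k <- box d.+1 N) F k =
  \sum_(i < N.*2.+1) \sum_(k <- box d N) F [tuple of (i%:Z - N%:Z) :: k].
Proof.
pose C (i : 'I_N.*2.+1) (k : d.-tuple int) : d.+1.-tuple int :=
  [tuple of ((i : nat)%:Z - N%:Z) :: k].
have -> : \sum_(i < N.*2.+1) \sum_(k <- box d N) F [tuple of (i%:Z - N%:Z) :: k] =
    \sum_(k <- [seq C i k | i <- enum 'I_N.*2.+1, k <- box d N]) F k.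
  by rewrite big_allpairs_dep big_enum.
apply: perm_big; apply: uniq_perm; first exact: uniq_box.
  apply: allpairs_uniq; rewrite ?enum_uniq ?uniq_box// => -[i k] [i' k'] _ _ /= E.
  have /(congr1 val) /= [Ei Ek] := E.
  by congr (_, _); apply: val_inj => //=; lia.
move=> k; rewrite mem_box; apply/forallP/allpairsP => [kN|[[i k'] [_ k'N ->]] j].
  have k0 := kN ord0.
  exists (inord (absz (tnth k ord0 + N%:Z)), [tuple of behead k]); split=> /=.
  - by rewrite mem_enum.
  - rewrite mem_box; apply/forallP => j.
    by have := kN (lift ord0 j); rewrite {1}(tuple_eta k) tnthS.
  - rewrite [LHS]tuple_eta; apply: val_inj => /=; congr (_ :: _).
    by rewrite inordK /thead; move: (tnth k ord0) k0 => z z0; lia.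
case: (unliftP ord0 j) => [j'|] ->; rewrite /C /=.
  by rewrite tnthS; move: k'N; rewrite mem_box => /forallP/(_ j').
rewrite tnth0; have := ltn_ord i; lia.
Qed.

Lemma zeta_le (r : R) N : 1 < r ->
  \sum_(i < N.*2.+1) hz (i%:Z - N%:Z) `^ (- r) <= 3 * (1 + (r - 1)^-1).
Proof.
move=> r1; have r0 : 0 < r - 1 by rewrite subr_gt0.
apply: le_trans (symmetric_sum_le (g := fun k => k%:R `^ (- r)) N _) _.
  by move=> k; exact: powR_ge0.
rewrite ler_pM2l//; have := @sum_powRN_le R (r - 1) N.+1 r0.
by rewrite subrK.
Qed.

Lemma hmix_zeta_le d (r : R) N : 1 < r ->
  \sum_(k <- box d N) hmix k `^ (- r) <= (3 * (1 + (r - 1)^-1)) ^+ d.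
Proof.
move=> r1; under eq_bigr do rewrite hmix_powR.
rewrite (prod_box_sum N (fun _ z => hz z `^ (- r))).
rewrite -[X in _ ^+ X]card_ord -prodr_const; apply: ler_prod => j _.
by rewrite zeta_le// sumr_ge0// => i _; exact: powR_ge0.
Qed.

(** For fixed remaining coordinates [k], the sum over the first one is [sum_decay_le] with
    [c = b / hmix k]. The resulting power of [hmix k] is summed as a product of [d] zeta-type sums,
    finite since [r > 1]. *)
Lemma effective_dimension_le d (a b r : R) N : 1 < a -> 0 < b -> 1 < r <= a ->
  \sum_(k <- box d.+1 N) (1 + (hmix k / b) `^ a)^-1 <=
  3 * (1 + (1 + 2 `^ a) / (a - 1)) * b `^ r * (3 * (1 + (r - 1)^-1)) ^+ d.
Proof.
move=> a1 b0 /andP[r1 ra]; rewrite box_cons_sum exchange_big /=.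
set K := 1 + (1 + 2 `^ a) / (a - 1).
have K0 : 0 <= K.
  have a10 : 0 <= a - 1 by rewrite subr_ge0 ltW.
  by rewrite addr_ge0// divr_ge0// addr_ge0// powR_ge0.
apply: (@le_trans _ _ (\sum_(k <- box d N) 3 * K * b `^ r * hmix k `^ (- r))); last first.
  by rewrite -mulr_sumr ler_wpM2l ?hmix_zeta_le// !mulr_ge0 ?powR_ge0.
apply: ler_sum => k _; have h0 := hmix_gt0 k.
have c0 : 0 < b / hmix k by rewrite divr_gt0.
under eq_bigr => i _.
  have -> : hmix [tuple of ((i : nat)%:Z - N%:Z) :: k] / b =
      hz (i%:Z - N%:Z) / (b / hmix k).
    rewrite /hmix big_ord_recl tnth0; under eq_bigr do rewrite tnthS.
    by rewrite -/(hmix k) invf_div mulrA.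
  over.
apply: le_trans (symmetric_sum_le (g := fun m => (1 + (m%:R / (b / hmix k)) `^ a)^-1) N _) _.
  by move=> m; rewrite invr_ge0 addr_ge0// powR_ge0.
have -> : 3 * K * b `^ r * hmix k `^ (- r) = 3 * (K * (b / hmix k) `^ r).
  have -> : b `^ r = (b / hmix k) `^ r * hmix k `^ r.
    by rewrite -powRM ?(ltW c0) ?(ltW h0)// divfK// gt_eqF.
  by rewrite powRN; field; rewrite gt_eqF// powR_gt0.
by rewrite ler_pM2l// sum_decay_le// (ltW r1).
Qed.

Lemma ln_nat_ge (n : nat) : (2 <= n)%N -> 0 < ln (2 : R) <= ln (n%:R : R).
Proof.
move=> n2; rewrite ln_gt0 ?ltr1n//=.
by rewrite ler_ln ?posrE ?ler_nat// ltr0n; lia.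
Qed.

Lemma effective_dimension_log d (a : R) : 1 < a -> exists2 K, 0 < K & forall n N : nat,
  (2 <= n)%N -> \sum_(k <- box d.+1 N)
    (1 + (hmix k / (n%:R / (K * ln n%:R ^+ d))) `^ a)^-1 <= n%:R / 16.
Proof.
move=> a1; have l2 : 0 < ln (2 : R) by rewrite ln_gt0// ltr1n.
have a0 : 0 < a - 1 by rewrite subr_gt0.
set K1 := 3 * (1 + (1 + 2 `^ a) / (a - 1)).
have K10 : 0 < K1.
  by rewrite mulr_gt0// ltr_pwDl// divr_ge0 ?(ltW a0).
(* Dividing by [ln 2] lets the constant [1 + (a - 1)^-1] be absorbed into a multiple of
   [L >= ln 2]. *)
set K2 := 3 * (1 + (1 + (a - 1)^-1) / ln 2).
have K20 : 0 < K2.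
  by rewrite mulr_gt0// ltr_pwDl// divr_ge0 ?(ltW l2)// addr_ge0// invr_ge0 ltW.
pose K3 := 16 * expR 1 * K1 * K2 ^+ d.
have K30 : 0 < K3 by rewrite /K3 mulr_gt0 ?exprn_gt0// mulr_gt0// mulr_gt0// expR_gt0.
(* [K3] collects the constants of the final estimate; the power of [ln 2] ensures [b <= n]. *)
pose K := Num.max K3 ((ln 2)^-1 ^+ d).
have K0 : 0 < K by rewrite lt_max K30.
exists K => // n N n2; have /andP[_ l2n] := ln_nat_ge n2.
have n0 : 0 < n%:R :> R by rewrite ltr0n; lia.
set L := ln n%:R in l2n *; have L0 : 0 < L := lt_le_trans l2 l2n.
have KL0 : 0 < K * L ^+ d by rewrite mulr_gt0// exprn_gt0.
set b := n%:R / (K * L ^+ d); have b0 : 0 < b by rewrite divr_gt0.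
have bn : b <= n%:R.
  rewrite ler_pdivrMr// ler_peMr ?(ltW n0)//.
  apply: (@le_trans _ _ ((ln 2)^-1 ^+ d * L ^+ d)).
    by rewrite -exprMn exprn_ege1// mulrC ler_pdivlMr// mul1r.
  by rewrite ler_wpM2r ?exprn_ge0 ?(ltW L0)// le_max lexx orbT.
(* The first entry keeps [1 + rho <= a]; the second makes n^rho at most e while [rho^-1] grows only
   like [L]. *)
set rho := Num.min (a - 1) L^-1.
have rho0 : 0 < rho by rewrite lt_min a0 invr_gt0.
have ra : 1 < 1 + rho <= a.
  rewrite ltrDl rho0/= -lerBrDl ge_min lexx//.
apply: le_trans (effective_dimension_le d N a1 b0 ra) _.
rewrite -/K1 [1 + rho]addrC addrK.
have brho : b `^ (rho + 1) <= b * expR 1.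
  rewrite powRD; last by rewrite (gt_eqF b0) implybT.
  rewrite powRr1 ?(ltW b0)// mulrC ler_pM2l//.
  apply: (@le_trans _ _ (n%:R `^ rho)).
    by apply: ge0_ler_powR; rewrite ?nnegrE ?(ltW rho0) ?(ltW b0)// ltW.
  rewrite /powR gt_eqF// ler_expR -/L -ler_pdivlMr// div1r.
  by rewrite ge_min lexx orbT.
have rhoL : 3 * (1 + rho^-1) <= K2 * L.
  have r1 : rho^-1 <= (a - 1)^-1 + L.
    rewrite /rho minElt; case: ifP => _; first by rewrite lerDl ltW.
    by rewrite invrK lerDr invr_ge0 ltW.
  have : (1 + (a - 1)^-1) <= (1 + (a - 1)^-1) / ln 2 * L.
    rewrite mulrAC -mulrA ler_peMr ?addr_ge0 ?invr_ge0 ?(ltW a0)//.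
    by rewrite ler_pdivlMr// mul1r.
  rewrite /K2; lra.
apply: (@le_trans _ _ (K1 * (b * expR 1) * (K2 * L) ^+ d)).
  have rho1 : 0 <= 1 + rho^-1 by rewrite addr_ge0// invr_ge0 ltW.
  apply: ler_pM.
  - by rewrite mulr_ge0 ?powR_ge0// (ltW K10).
  - by rewrite exprn_ge0// mulr_ge0.
  - by rewrite ler_pM2l.
  - by rewrite lerXn2r ?nnegrE ?(mulr_ge0 _ rho1)// (mulr_ge0 (ltW K20)) ?(ltW L0).
rewrite exprMn.
have -> : K1 * (b * expR 1) * (K2 ^+ d * L ^+ d) = K3 / 16 * (b * L ^+ d).
  by rewrite /K3; field.
have -> : b * L ^+ d = n%:R / K.
  by rewrite /b; field; rewrite !gt_eqF// exprn_gt0.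
rewrite mulrAC ler_pM2r//.
rewrite mulrCA ger_pMr// ler_pdivrMr// mul1r.
by rewrite le_max lexx.
Qed.

End BoxSums.

(** * Lower bounds for the weights of H^s_mix *)

Section Weights.
Context {R : realType}.

Definition mixed_weight (s : R) d (k : d.-tuple int) : R :=
  \prod_(j < d) weight s (tnth k j) ^+ 2.

Lemma weight_sqr_ge (s : R) (z : int) : 0 < s -> hz z `^ (2 * s) <= weight s z ^+ 2.
Proof.
move=> s0; have s20 : 0 < 2 * s by rewrite mulr_gt0.
have P0 := powR_ge0 (2 * pi * `|z%:~R : R|) (2 * s).
rewrite /weight sqr_sqrtr ?addr_ge0// /hz.
have [z0|z0] := eqVneq z 0.
  by rewrite {1}z0 powR1 lerDl.
rewrite (maxn_idPr _); last by rewrite absz_gt0.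
rewrite natr_absz intr_norm; apply: ler_wpDl => //.
apply: ge0_ler_powR; rewrite ?nnegrE ?(ltW s20)// ?mulr_ge0 ?pi_ge0//.
rewrite ler_peMl//; have := pi_ge2 R; lra.
Qed.

Lemma mixed_weight_ge (s : R) d (k : d.-tuple int) : 0 < s ->
  hmix k `^ (2 * s) <= mixed_weight s k.
Proof.
move=> s0; rewrite hmix_powR; apply: ler_prod => j _.
by rewrite powR_ge0 weight_sqr_ge.
Qed.

Lemma mixed_weight_gt0 (s : R) d (k : d.-tuple int) : 0 < s -> 0 < mixed_weight s k.
Proof.
by move=> s0; apply: lt_le_trans (mixed_weight_ge k s0); rewrite powR_gt0 ?hmix_gt0.
Qed.

End Weights.

(** * Sampling numbers *)

Section HmixBall.
Context {R : realType} {d : nat}.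
Implicit Types f g h : d.-tuple R -> R[i].

Lemma Hmix_norm_le1_box (s : R) f N : (Hmix_norm s f <= 1)%E ->
  \sum_(k <- box d N) mixed_weight s k * sqnorm (fourier_coef f k) <= 1.
Proof.
rewrite /Hmix_norm; have -> : 1%E = sqrte 1%E :> \bar R by rewrite /= sqrtr1.
rewrite lee_sqrt// => le1; rewrite -lee_fin; apply: le_trans le1.
apply: esum_ge; exists [set` box d N]; first by split => //; exact: finite_seq.
rewrite -fsbig_seq ?uniq_box// sumEFin lee_fin ler_sum// => k _.
by rewrite sqr_normc mulrC.
Qed.

Lemma torus_continuousB f g : torus_continuous f -> torus_continuous g ->
  torus_continuous (f \- g).
Proof.
move=> [pf cf] [pg cg]; split=> [k x|x]; first by rewrite /= pf pg.
exact: cvgB (cf x) (cg x).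
Qed.

Lemma fourier_coefB f g k : torus_continuous f -> torus_continuous g ->
  fourier_coef (f \- g) k = fourier_coef f k - fourier_coef g k.
Proof.
move=> cf cg; rewrite /fourier_coef; pose e x : R[i] := cexpi (- phase k x).
have be : cbounded_measurable e by exact: cbounded_measurable_cexpiN.
have bfe := cbounded_measurableM (torus_continuous_cbounded cf) be.
have bge := cbounded_measurableM (torus_continuous_cbounded cg) be.
apply/eqP; rewrite eq_complex !raddfB /=; apply/andP; split; apply/eqP.
  rewrite -torus_RintegralB; [|exact: bfe.1|exact: bge.1].
  by apply: eq_Rintegral => x _; rewrite mulrBl raddfB.
rewrite -torus_RintegralB; [|exact: bfe.2|exact: bge.2].
by apply: eq_Rintegral => x _; rewrite mulrBl raddfB.
Qed.

(** The multipliers are at most 1, and |u - v|^2 <= 2(|u|^2 + |v|^2) bounds the energy by 2(1 +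
    1). *)
Lemma fejer_energy_le (s : R) f g N : 0 < s ->
  torus_continuous f -> torus_continuous g ->
  (Hmix_norm s f <= 1)%E -> (Hmix_norm s g <= 1)%E ->
  \sum_(k <- box d N) mixed_weight s k *
    sqnorm ((kappa N k)%:C * fourier_coef (f \- g) k) <= 4.
Proof.
move=> s0 cf cg /(@Hmix_norm_le1_box s f N) f1 /(@Hmix_norm_le1_box s g N) g1.
apply: (@le_trans _ _ (\sum_(k <- box d N)
    (2 * (mixed_weight s k * sqnorm (fourier_coef f k)) +
     2 * (mixed_weight s k * sqnorm (fourier_coef g k))))); last first.
  rewrite big_split -!mulr_sumr /=; lra.
apply: ler_sum => k _; rewrite fourier_coefB// sqnormM.
rewrite ![2 * (mixed_weight s k * _)]mulrCA -mulrDr -mulrDr ler_pM2l ?mixed_weight_gt0//.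
apply: le_trans (sqnormB_le _ _).
rewrite ler_piMl ?sqnorm_ge0// /sqnorm /= expr0n addr0 expr_le1//; first exact: kappa_le1.
exact: kappa_ge0.
Qed.

(** Sample points must lie in [0,1)^d, whereas the selection yields arbitrary real points;
    periodicity allows the reduction. *)
Definition torus_frac (x : d.-tuple R) : d.-tuple R :=
  [tuple tnth x j + (- Num.floor (tnth x j))%:~R | j < d].

Lemma in_cube_torus_frac x : in_cube (torus_frac x).
Proof.
move=> j; rewrite tnth_mktuple mulrNz.
by have /andP[] := floor_itv (tnth x j); rewrite intrD; lra.
Qed.

Lemma torus_frac_periodic h x : torus_continuous h -> h (torus_frac x) = h x.
Proof.
move=> [ph _]; rewrite -(ph [tuple - Num.floor (tnth x j) | j < d] x).
by congr h; apply: eq_from_tnth => j; rewrite !tnth_mktuple.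
Qed.

Lemma torus_continuous_L2 h : torus_continuous h -> L2 h.
Proof.
move=> /torus_continuous_cbounded bh.
by split; [exact: bh.1.1|exact: bh.2.1|rewrite L2_normE// ltry].
Qed.

(** The reconstruction map: some unit-ball function with the given data, taken by choice, and zero
    when the data come from no such function. *)
Definition interpolant (s : R) n (xs : n.-tuple (d.-tuple R)) (y : n.-tuple R[i])
    : d.-tuple R -> R[i] :=
  match pselect (exists g, [/\ torus_continuous g, (Hmix_norm s g <= 1)%E &
                            [tuple g (tnth xs i) | i < n] = y]) with
  | left e => sval (cid e)
  | right _ => fun=> 0
  end.

Lemma L2_interpolant (s : R) n (xs : n.-tuple (d.-tuple R)) y : L2 (interpolant s xs y).
Proof.
rewrite /interpolant; case: pselect => [e|_].
  by case: (cid e) => g /= [cg _ _]; exact: torus_continuous_L2.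
by apply: torus_continuous_L2; split=> //; exact: cst_continuous.
Qed.

(** The target [f] and its reconstruction lie in the unit ball and share their data, so the
    difference vanishes at the points and has energy at most 4. Hence [8 * lam = 2 * lam * 4],
    whatever the value of [B]. *)
Lemma sampling_number_le (s lam B : R) n (xs : 'I_n -> d.-tuple R) N0 : 0 < s ->
  (forall N, (N0 <= N)%N -> forall c,
    \sum_(k <- box d N) sqnorm (c k) <=
      2 * lam * (\sum_(k <- box d N) mixed_weight s k * sqnorm (c k)) +
      B * \sum_i sqnorm (trigpoly (box d N) c (xs i))) ->
  0 < lam ->
  (sampling_number d s n <= (Num.sqrt (8 * lam))%:E)%E.
Proof.
move=> s0 samp lam0; pose ys := [tuple torus_frac (xs i) | i < n].
apply: le_trans (ereal_inf_lbound _) _.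
  exists ys => //= i; rewrite tnth_mktuple; exact: in_cube_torus_frac.
apply: le_trans (ereal_inf_lbound _) _.
  by exists (interpolant s ys) => //= y; exact: L2_interpolant.
apply: ge_ereal_sup => _ [f /= [[cf _] f1] <-].
set y := [tuple _ | _ < _].
have [cg g1 gy] : [/\ torus_continuous (interpolant s ys y),
    (Hmix_norm s (interpolant s ys y) <= 1)%E &
    [tuple interpolant s ys y (tnth ys i) | i < n] = y].
  rewrite {1 2 3}/interpolant.
  case: pselect => [e|[]]; last by exists f.
  by case: (cid e).
set g := interpolant s ys y in cg g1 gy *.
have ch := torus_continuousB cf cg.
apply: (L2_norm_le_sampling (B := B) (xs := xs) ch) => [i|].
  have := congr1 (fun u => tnth u i) gy; rewrite !tnth_mktuple => gi.
  by rewrite -(torus_frac_periodic _ ch) /= gi subrr.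
exists N0 => // N /= NN; apply: le_trans (samp N NN _) _.
rewrite lerD2r (_ : 8 * lam = 2 * lam * 4); last by ring.
by rewrite ler_pM2l ?mulr_gt0//; exact: fejer_energy_le.
Qed.

End HmixBall.

Theorem mainTheorem3 (R : realType) (d : nat) (s : R) :
  (0 < d)%N -> 1 / 2 < s ->
  exists C : R, 0 < C /\
    forall n : nat, (2 <= n)%N ->
      (sampling_number d s n <=
       (C * n%:R `^ (- s) * ln n%:R `^ ((d%:R - 1) * s + 1 / 2))%:E)%E.
Proof.
case: d => // d _ s12.
have s0 : 0 < s by lra.
set a := 2 * s; have a1 : 1 < a by rewrite /a; lra.
have a0 : 0 < a by lra.
have [K K0 HK] := effective_dimension_log d a1.
have l2 : 0 < ln (2 : R) by rewrite ln_gt0// ltr1n.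
(* The power of [ln 2] makes the factor (log n)^(1/2) of the target at least 1 after scaling,
   uniformly in [n >= 2]. *)
exists (Num.sqrt 8 * K `^ s * (ln 2) `^ (- (1 / 2))); split.
  by rewrite !mulr_gt0 ?sqrtr_gt0 ?powR_gt0.
move=> n n2; have /andP[_ l2n] := @ln_nat_ge R n n2.
have n0 : 0 < n%:R :> R by rewrite ltr0n; lia.
set L := ln n%:R in l2n *; have L0 : 0 < L := lt_le_trans l2 l2n.
set b := n%:R / (K * L ^+ d).
have KL0 : 0 < K * L ^+ d by rewrite mulr_gt0// exprn_gt0.
have b0 : 0 < b by rewrite divr_gt0.
(* With this choice [(hmix k / b)]^ a[equals]lam * hmix k [^ a], which is at most [lam] times the
   weight, so [HK] bounds the initial potential. *)
set lam := b `^ (- a); have lam0 : 0 < lam by rewrite powR_gt0.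
have n0N : (0 < n)%N by lia.
have W0 (k : d.+1.-tuple int) : 0 < mixed_weight s k by exact: mixed_weight_gt0.
(* Any bound uniform in [N] will do: it only guarantees a small tail outside some box and does not
   enter the constant. *)
have sumB N : \sum_(k <- box d.+1 N) (mixed_weight s k)^-1 <=
    (3 * (1 + (a - 1)^-1)) ^+ d.+1.
  apply: le_trans (hmix_zeta_le d.+1 N a1); apply: ler_sum => k _.
  by rewrite powRN lef_pV2 ?posrE ?powR_gt0 ?hmix_gt0// mixed_weight_ge.
have eff N : \sum_(k <- box d.+1 N) (lam * mixed_weight s k + 1)^-1 <= n%:R / 16.
  apply: le_trans (HK n N n2); apply: ler_sum => k _.
  have h0 := @hmix_gt0 R _ k.
  rewrite lef_pV2 ?posrE ?addr_gt0 ?mulr_gt0 ?powR_gt0 ?divr_gt0//.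
  rewrite addrC lerD2r -/L -/b.
  have -> : (hmix k / b) `^ a = lam * hmix k `^ a.
    have E : hmix k `^ a = (hmix k / b) `^ a * b `^ a.
      by rewrite -powRM ?(ltW b0) ?(ltW (divr_gt0 h0 b0))// divfK// gt_eqF.
    by rewrite E /lam powRN; field; rewrite gt_eqF// powR_gt0.
  by rewrite ler_pM2l// mixed_weight_ge.
have [xs [N0 samp]] := trigpoly_sampling n0N lam0 W0 sumB eff.
apply: le_trans (sampling_number_le s0 samp lam0) _.
rewrite lee_fin sqrtrM//.
have -> : Num.sqrt lam = n%:R `^ (- s) * (K `^ s * L `^ (d%:R * s)).
  have -> : lam = (b `^ (- s)) ^+ 2.
    by rewrite -powR_mulrn ?powR_ge0// -powRrM /lam /a; congr (_ `^ _); ring.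
  rewrite sqrtr_sqr ger0_norm ?powR_ge0//.
  have E : n%:R `^ s = b `^ s * (K `^ s * L `^ (d%:R * s)).
    rewrite powRrM powR_mulrn ?(ltW L0)// -powRM ?(ltW K0) ?exprn_ge0 ?(ltW L0)//.
    by rewrite -powRM ?(ltW b0) ?(ltW KL0)// /b divfK// gt_eqF.
  by rewrite !powRN E; field; rewrite !gt_eqF// ?mulr_gt0 ?powR_gt0.
have -> : (d.+1%:R - 1) * s + 1 / 2 = d%:R * s + 1 / 2 :> R.
  by rewrite -natr1 addrK.
rewrite powRD; last by rewrite (gt_eqF L0) implybT.
have P : 1 <= (ln 2) `^ (- (1 / 2)) * L `^ (1 / 2) :> R.
  rewrite powRN mulrC ler_pdivlMr ?powR_gt0// !mul1r.
  by apply: ge0_ler_powR; rewrite ?nnegrE ?(ltW l2) ?(ltW L0)//; lra.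
have -> : Num.sqrt 8 * K `^ s * ln 2 `^ (- (1 / 2)) * n%:R `^ (- s) *
    (L `^ (d%:R * s) * L `^ (1 / 2)) =
  Num.sqrt 8 * (n%:R `^ (- s) * (K `^ s * L `^ (d%:R * s))) *
    (ln 2 `^ (- (1 / 2)) * L `^ (1 / 2)) by ring.
by rewrite ler_peMr// !mulr_ge0 ?powR_ge0 ?sqrtr_ge0.
Qed.
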